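(* Let $P,Q,A_1,\dots,A_r,B_1,\dots,B_s\in\mathbb{C}^{N\times N}$ be pairwise commuting matrices with $\Re(P)>0$, $\Re(Q)>0$, $\Re(A_i)>0$ for $1\le i\le r$ and $\Re(B_j)>0$ for $1\le j\le s$. Let $x>0$, $t>0$ and let $k\ge1$ be an integer. Then $$\int_0^t u^{P-I}(t-u)^{Q-I}\;{}_{r}E_{s}\left[(x,P,Q;zu^k)\left|\begin{matrix}A_1,\dots,A_r\\ B_1,\dots,B_s\end{matrix}\right.\right]du=\mathbf{B}(P,Q)\,t^{P+Q-I}\;{}_{r+k}E_{s+k}\left[(x,P,Q;zt^k)\left|\begin{matrix}A_1,\dots,A_r,\Delta(k,P)\\ B_1,\dots,B_s,\Delta(k,P+Q)\end{matrix}\right.\right].$$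
   Context: $I$ is the identity matrix in $\mathbb{C}^{N\times N}$; $t^{M}=\exp(M\ln t)$ for $t>0$; $\Re(M)>0$ means that every eigenvalue of $M$ has positive real part. For $\Re(M)>0$ and $x>0$: $\Gamma(M,x)=\int_x^\infty u^{M-I}e^{-u}du$, $\Gamma(M)=\int_0^\infty u^{M-I}e^{-u}du$, $\Gamma^{-1}(M)=\Gamma(M)^{-1}$. For commuting $P,Q$ with $\Re(P),\Re(Q)>0$, the beta matrix function is $\mathbf{B}(P,Q)=\int_0^1 t^{P-I}(1-t)^{Q-I}dt=\Gamma(P)\Gamma(Q)\Gamma^{-1}(P+Q)$. Pochhammer symbol: $(M)_0=I$, $(M)_\ell=M(M+I)\cdots(M+(\ell-1)I)$. $\Delta(k,M)$ denotes the sequence of $k$ parameters $\frac{M}{k},\frac{M+I}{k},\dots,\frac{M+(k-1)I}{k}$. The generalized incomplete exponential matrix function is $${}_rE_s\left[(x,P,Q;z)\left|\begin{matrix}A_1,\dots,A_r\\ B_1,\dots,B_s\end{matrix}\right.\right]=\sum_{\ell=0}^\infty \frac{z^\ell}{\ell!}\prod_{i=1}^r(A_i)_\ell\Big[\prod_{j=1}^s(B_j)_\ell\Big]^{-1}\Gamma(\ell P+Q,x)\Gamma^{-1}(\ell P+Q).$$ The identity is understood for those $z\in\mathbb{C}$ for which the series involved converge. *)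

(* Defs.v *)
From HB Require Import structures.
From mathcomp Require Import all_boot all_order all_algebra.
From mathcomp Require Import complex.
From mathcomp Require Import all_classical all_reals all_analysis.

Set Implicit Arguments.
Unset Strict Implicit.
Unset Printing Implicit Defensive.

Import Order.TTheory GRing.Theory Num.Theory.
Import numFieldNormedType.Exports.

Local Open Scope classical_set_scope.
Local Open Scope ring_scope.

(* The usual topology and norm of C, transported from the canonical ones of the
   regular module R[i]^o of the field R[i]. *)
HB.instance Definition _ (R : realType) := NormedModule.copy R[i] R[i]^o.

(* Complex N x N matrices are 'M[R[i]]_n.+1 with N = n.+1, which carries a unit
   ring structure (1 is the identity matrix, M^-1 is invmx M) and the topology
   of entrywise convergence. *)
Section MatrixFunctions.
Variables (R : realType) (n : nat).
Local Notation mat := 'M[R[i]]_n.+1.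
Implicit Types (M P Q : mat) (A B : seq mat).

Definition positive_stable M : Prop :=
  forall a : R[i], eigenvalue M a -> 0 < complex.Re a.

Definition mx_exp M : mat :=
  limn (series (fun l : nat => (l`!%:R : R[i])^-1 *: M ^+ l)).

Definition mx_pow (t : R) M : mat := mx_exp ((ln t)%:C%C *: M).

Definition mx_integral (f : R -> mat) (c d : R) : mat :=
  \matrix_(i, j)
    Complex (\int[lebesgue_measure]_(u in `[c, d]) complex.Re (f u i j))
            (\int[lebesgue_measure]_(u in `[c, d]) complex.Im (f u i j)).

Definition mx_integrable (f : R -> mat) (c d : R) : Prop :=
  forall i j,
    lebesgue_measure.-integrable `[c, d]
      (fun u => (complex.Re (f u i j))%:E) /\
    lebesgue_measure.-integrable `[c, d]
      (fun u => (complex.Im (f u i j))%:E).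

(* Every integral of the theory may be singular at both ends, so it is read as
   the limit of the integrals over the segments [c, d] when c tends to the lower
   end along F and, independently, d tends to the upper end along G: e.g.
   F = 0^'+ and G = t^'- give the integral from 0 to t. *)
Definition is_improper_integral (f : R -> mat) (F G : set_system R) M : Prop :=
  (\forall cd \near filter_prod F G, mx_integrable f cd.1 cd.2) /\
  (fun cd : R * R => mx_integral f cd.1 cd.2) @ filter_prod F G --> M.

Definition improper_integral (f : R -> mat) (F G : set_system R) : mat :=
  lim ((fun cd : R * R => mx_integral f cd.1 cd.2) @ filter_prod F G).

Definition gamma_integrand M (u : R) : mat :=
  (expR (- u))%:C%C *: mx_pow u (M - 1).

Definition mx_Gamma M : mat :=
  improper_integral (gamma_integrand M) 0^'+ +oo.

Definition mx_inc_Gamma M (x : R) : mat :=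
  improper_integral (gamma_integrand M) x^'+ +oo.

Definition mx_Beta P Q : mat :=
  improper_integral
    (fun u => mx_pow u (P - 1) * mx_pow (1 - u) (Q - 1)) 0^'+ 1^'-.

Definition pochhammer M (l : nat) : mat := \prod_(i < l) (M + i%:R).

Definition Delta (k : nat) M : seq mat :=
  [seq (k%:R : R[i])^-1 *: (M + i%:R) | i <- iota 0 k].

Definition inc_exp_term (x : R) P Q (z : R[i]) A B (l : nat) : mat :=
  (z ^+ l / l`!%:R) *:
    ((\prod_(M <- A) pochhammer M l) * (\prod_(M <- B) pochhammer M l)^-1 *
     mx_inc_Gamma (P *+ l + Q) x * (mx_Gamma (P *+ l + Q))^-1).

Definition inc_exp_cvg (x : R) P Q (z : R[i]) A B : Prop :=
  cvgn (series (inc_exp_term x P Q z A B)).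

(* The numbers r and s of the notation r_E_s are the lengths of A and B. *)
Definition inc_exp (x : R) P Q (z : R[i]) A B : mat :=
  limn (series (inc_exp_term x P Q z A B)).

End MatrixFunctions.

(* Main.v *)
Require Import Defs.
From HB Require Import structures.
From mathcomp Require Import all_boot all_order all_algebra.
From mathcomp Require Import complex ring lra.
From mathcomp Require Import all_classical all_reals all_analysis.

Set Implicit Arguments.
Unset Strict Implicit.
Unset Printing Implicit Defensive.

Import Order.TTheory GRing.Theory Num.Theory.
Import numFieldNormedType.Exports.

Local Open Scope classical_set_scope.
Local Open Scope ring_scope.

(* Let b_l be the terms of the right-hand series, S its sum and
   T_l = b_l + b_(l+1) + ... its tails.  Since the Pochhammer symbols of the
   entries of Delta(k, M) multiply to k^(-kl) (M)_(kl), the left-hand series at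
   u = t v is F(v) = sum_l v^(kl) (P)_(kl)^-1 (P+Q)_(kl) b_l.  Summation by
   parts gives, with X(v) = sum_j v^j (P)_(j+1)^-1 (P+Q)_j T_(floor(j/k)+1),

     v^(P-I) (1-v)^(Q-I) F(v) = v^(P-I) (1-v)^(Q-I) S - d/dv [v^P (1-v)^Q X(v)],

   so no interchange of sum and integral is needed.  The boundary term vanishes
   even when the right-hand series converges only conditionally:
   (P)_(j+1)^-1 (P+Q)_j grows like j^(Q-I), so that
   sum_j v^j |(1-v)^Q (P)_(j+1)^-1 (P+Q)_j| is bounded for 0 < v < 1, while
   T_l -> 0.  Eigenvalues only enter through |v^Q| <= K v^d (1+v)^D with d > 0,
   which follows from the Cayley-Hamilton theorem. *)

(** * Real components of complex matrices *)

Section RealComponents.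
Variables (R : realType) (n : nat).
Local Notation mat := 'M[R[i]]_n.+1.
Local Notation idx := ('I_n.+1 * 'I_n.+1 * bool)%type.
Implicit Types (M N : mat) (c : idx) (z w : R[i]).

(** Conditional convergence at the end point offers no integrable majorant for a termwise
    integration. The integral is instead the increment of a primitive that has limits at both ends,
    and the beta function itself enters as the increment of a primitive of its density. The series X
    comes from d/dv [v^(P+j) (1-v)^Q] = v^(P+j-I) (1-v)^(Q-I) ((P+j) - v (P+Q+j)). The factors
    (P)_(j+1)^-1 (P+Q)_j turn the two contributions to the power v^j into the same quotient (P)_j^-1
    (P+Q)_j. What is left is the difference of two consecutive tail factors, which is zero unless k
    divides j. The incomplete gamma quotients are common to both sides and stay inside b_l. In the
    analytic part b_l is thus an arbitrary sequence of matrices with a convergent series: b_l and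
    the tails stay to the right of everything, and only P, Q and what is built from them are moved
    past one another. *)

Definition cpart (b : bool) (z : R[i]) : R :=
  if b then complex.Re z else complex.Im z.

Definition mxpart c M : R := cpart c.2 (M c.1.1 c.1.2).

Lemma cpartD b z w : cpart b (z + w) = cpart b z + cpart b w.
Proof. by case: b z w => -[? ?] [? ?]. Qed.

Lemma cpartZ b (r : R) z : cpart b (r%:C%C * z) = r * cpart b z.
Proof. by case: b z => -[a d]; rewrite /cpart /= ?mul0r ?subr0 ?addr0. Qed.

Lemma cpart_le b z : (`|cpart b z|)%:C%C <= `|z|.
Proof.
case: z => a d; rewrite normc_def lecR -sqrtr_sqr ler_wsqrtr//.
by case: b => /=; rewrite ?lerDl ?lerDr sqr_ge0.
Qed.

Lemma normc_le z : `|z| <= (`|complex.Re z| + `|complex.Im z|)%:C%C.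
Proof.
case: z => a d; rewrite normc_def lecR /=.
have h : 0 <= `|a| + `|d| by rewrite addr_ge0.
rewrite -(ger0_norm h) -sqrtr_sqr ler_wsqrtr// sqrrD !real_normK ?num_real//.
by rewrite lerD2r lerDl mulrn_wge0// mulr_ge0.
Qed.

Lemma ball_complexE z (e : R[i]) w : ball z e w = (`|z - w| < e) :> Prop.
Proof. by rewrite -(@ball_normE R[i] R[i]). Qed.

Lemma mxpartD c M N : mxpart c (M + N) = mxpart c M + mxpart c N.
Proof. by rewrite /mxpart mxE cpartD. Qed.

Lemma mxpartZ c (r : R) M : mxpart c (r%:C%C *: M) = r * mxpart c M.
Proof. by rewrite /mxpart mxE cpartZ. Qed.

Lemma mxpart0 c : mxpart c 0 = 0.
Proof. by rewrite /mxpart mxE /cpart; case: c.2. Qed.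

Lemma mxpartN c M : mxpart c (- M) = - mxpart c M.
Proof. by apply/eqP; rewrite -subr_eq0 opprK -mxpartD addNr mxpart0. Qed.

Lemma mxpartB c M N : mxpart c (M - N) = mxpart c M - mxpart c N.
Proof. by rewrite mxpartD mxpartN. Qed.

Lemma mxpart_sum c I (s : seq I) (p : pred I) (F : I -> mat) :
  mxpart c (\sum_(i <- s | p i) F i) = \sum_(i <- s | p i) mxpart c (F i).
Proof. exact: (big_morph _ (mxpartD c) (mxpart0 c)). Qed.

Lemma mxpart_inj M N : (forall c, mxpart c M = mxpart c N) -> M = N.
Proof.
move=> h; apply/matrixP => i j; move: (h (i, j, true)) (h (i, j, false)).
by rewrite /mxpart /cpart /=; case: (M i j) (N i j) => a b [a' b'] /= -> ->.
Qed.

Definition cunit c : mat :=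
  (if c.2 then 1 else Complex 0 1) *: delta_mx c.1.1 c.1.2.

Lemma mxpart_decomp M : M = \sum_c (mxpart c M)%:C%C *: cunit c.
Proof.
rewrite -(pair_bigA _ (fun ij b => (mxpart (ij, b) M)%:C%C *: cunit (ij, b)))
  /=.
rewrite -(pair_bigA _ (fun i j => \sum_b (mxpart (i, j, b) M)%:C%C *: cunit (i,
  j, b))) /=.
rewrite {1}[M]matrix_sum_delta; apply: eq_bigr => i _; apply: eq_bigr => j _.
rewrite big_bool /= /cunit /= !scalerA -scalerDl; congr (_ *: _).
rewrite /mxpart /cpart /=; case: (M i j) => a b /=.
by apply/eqP; rewrite eq_complex /=; apply/andP; split; apply/eqP; ring.
Qed.

(** Structure constants of the matrix algebra in the real basis [cunit]. They make a product a real
    bilinear form in the components, so limits and derivatives of products reduce to real ones. *)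
Definition cst_struct c a b : R := mxpart c (cunit a * cunit b).

Lemma mxpartM c M N :
  mxpart c (M * N) = \sum_a \sum_b cst_struct c a b * (mxpart a M * mxpart b N).
Proof.
rewrite {1}[M]mxpart_decomp {1}[N]mxpart_decomp mulr_suml mxpart_sum.
apply: eq_bigr => a _; rewrite mulr_sumr mxpart_sum; apply: eq_bigr => b _.
by rewrite -scalerAl -scalerAr scalerA -rmorphM mxpartZ mulrC.
Qed.

(** A real-valued submultiplicative norm. It is not normalised: the identity has norm equal to the
    size of the matrix, hence the factors [l1norm 1] in later bounds. *)
Definition l1norm M : R := \sum_c `|mxpart c M|.

Lemma l1norm_ge0 M : 0 <= l1norm M. Proof. by apply: sumr_ge0. Qed.

Lemma mxpart_le_l1norm c M : `|mxpart c M| <= l1norm M.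
Proof. by rewrite /l1norm (bigD1 c)//= lerDl sumr_ge0. Qed.

Lemma l1normD M N : l1norm (M + N) <= l1norm M + l1norm N.
Proof. by rewrite /l1norm -big_split ler_sum// => c _;
  rewrite mxpartD ler_normD. Qed.

Lemma l1norm0 : l1norm 0 = 0.
Proof. by rewrite /l1norm big1// => c _; rewrite mxpart0 normr0. Qed.

Lemma l1normN M : l1norm (- M) = l1norm M.
Proof. by apply: eq_bigr => c _; rewrite mxpartN normrN. Qed.

Lemma l1normB M N : l1norm (M - N) <= l1norm M + l1norm N.
Proof. by rewrite -(l1normN N) l1normD. Qed.

Lemma l1norm_distC M N : l1norm (M - N) = l1norm (N - M).
Proof. by rewrite -l1normN opprB. Qed.

Lemma l1normZ (r : R) M : l1norm (r%:C%C *: M) = `|r| * l1norm M.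
Proof. by rewrite /l1norm mulr_sumr; apply: eq_bigr => c _;
  rewrite mxpartZ normrM. Qed.

Lemma l1norm_sum I (s : seq I) (p : pred I) (F : I -> mat) :
  l1norm (\sum_(i <- s | p i) F i) <= \sum_(i <- s | p i) l1norm (F i).
Proof.
apply: (big_ind2 (fun M r => l1norm M <= r)) => //; first by rewrite l1norm0.
by move=> M r N r' h h'; rewrite (le_trans (l1normD _ _))// lerD.
Qed.

Lemma l1normE M : l1norm M = \sum_i \sum_j (`|complex.Re (M i j)| +
  `|complex.Im (M i j)|).
Proof.
rewrite /l1norm -(pair_bigA _ (fun ij b => `|mxpart (ij, b) M|)) /=.
rewrite -(pair_bigA _ (fun i j => \sum_b `|mxpart (i, j, b) M|)) /=.
by apply: eq_bigr => i _; apply: eq_bigr => j _; rewrite big_bool.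
Qed.

(** Already [|Re z| + |Im z|] is submultiplicative on complex numbers; the double sum over matching
    inner indices is then enlarged to independent ones. *)
Lemma l1normM M N : l1norm (M * N) <= l1norm M * l1norm N.
Proof.
pose m z : R := `|complex.Re z| + `|complex.Im z|.
have m0 z : 0 <= m z by rewrite addr_ge0.
have mM z w : m (z * w) <= m z * m w.
  case: z w => a b [a' b']; rewrite /m /= mulrDl !mulrDr -!normrM.
  have := ler_normB (a * a') (b * b').
  by have := ler_normD (a * b') (b * a'); lra.
have mS (I : finType) (F : I -> R[i]) : m (\sum_i F i) <= \sum_i m (F i).
  apply: (big_ind2 (fun z r => m z <= r)) => //.
    by rewrite /m /= normr0 addr0.
  move=> [a b] r [a' b'] r'; rewrite /m /=.
  by have := ler_normD a a'; have := ler_normD b b'; lra.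
rewrite !l1normE -/(m _).
apply: (@le_trans _ _ (\sum_i \sum_j \sum_k m (M i k) * m (N k j))).
  apply: ler_sum => i _; apply: ler_sum => j _;
    rewrite mxE (le_trans (mS _ _))//.
  by apply: ler_sum.
rewrite mulr_suml; apply: ler_sum => i _.
rewrite exchange_big mulr_suml; apply: ler_sum => k _ /=.
rewrite -mulr_sumr ler_wpM2l// [leRHS](bigD1 k)//= lerDl.
by apply: sumr_ge0 => k' _; apply: sumr_ge0.
Qed.

Lemma l1normX M l : l1norm (M ^+ l) <= l1norm 1 * l1norm M ^+ l.
Proof.
elim: l => [|l IH]; first by rewrite !expr0 mulr1.
by rewrite !exprSr mulrA (le_trans (l1normM _ _))// ler_wpM2r// l1norm_ge0.
Qed.

Lemma cvg_bigsum T (F : set_system T) {FF : Filter F} I (s : seq I)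
    (f : I -> T -> R) (l : I -> R) :
  (forall i, f i x @[x --> F] --> l i) ->
  \sum_(i <- s) f i x @[x --> F] --> \sum_(i <- s) l i.
Proof.
move=> H; elim: s => [|i s IH].
  by rewrite big_nil; under eq_fun do rewrite big_nil; exact: cvg_cst.
by rewrite big_cons; under eq_fun do rewrite big_cons; exact: cvgD.
Qed.

Lemma cvg_mxpartP T (F : set_system T) {FF : Filter F} (f : T -> mat) M :
  f @ F --> M <-> forall c, mxpart c (f x) @[x --> F] --> mxpart c M.
Proof.
split=> [/cvg_ballP h [[i j] b]|h].
  apply/cvgrPdist_lt => e e0.
  have eC : (0 : R[i]) < e%:C%C by rewrite ltcR.
  have := h _ eC; apply: filterS => x [_ /(_ i j)].
  rewrite ball_complexE => hx.
  by rewrite -mxpartB -ltcR; apply: le_lt_trans hx;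
    rewrite /mxpart /= !mxE cpart_le.
apply/cvg_ballP => -[e e'] /= eC.
(* The radius of a ball over [R[i]] is a complex number; positivity forces its imaginary part to be
   0. *)
move: (eC); rewrite ltcE /= => /andP[/eqP e'0 e0]; rewrite {}e'0 in eC *.
have he : 0 < e / 2 by rewrite divr_gt0.
have : \forall x \near F, forall c, `|mxpart c M - mxpart c (f x)| < e / 2.
  by apply: filter_forall => c; have /cvgrPdist_lt := h c; exact.
apply: filterS => x hx; split => // i j.
rewrite ball_complexE.
apply: (le_lt_trans (normc_le _)); rewrite ltcR.
have := hx (i, j, true); have := hx (i, j, false).
rewrite -!mxpartB /mxpart /= !mxE /cpart; lra.
Qed.

Lemma cvg_l1normP T (F : set_system T) {FF : Filter F} (f : T -> mat) M :
  f @ F --> M <-> l1norm (f x - M) @[x --> F] --> (0 : R).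
Proof.
rewrite cvg_mxpartP; split=> [h|h c].
  suff: \sum_c `|mxpart c (f x - M)| @[x --> F] --> \sum_(c : idx) (0 : R).
    by rewrite big1.
  apply: cvg_bigsum => c.
  have /cvgr_dist_le /= := h c.
  move=> hc; apply/cvgr0Pnorm_le => e e0; have := hc _ e0.
  by apply: filterS => x; rewrite normr_id mxpartB distrC.
apply/cvgrPdist_le => e e0; have /cvgr0Pnorm_le := h => /(_ _ e0).
apply: filterS => x; rewrite ger0_norm ?l1norm_ge0// => hx.
by rewrite distrC -mxpartB (le_trans (mxpart_le_l1norm _ _)).
Qed.

Lemma cvgM_mx T (F : set_system T) {FF : Filter F} (f g : T -> mat) M N :
  f @ F --> M -> g @ F --> N -> f x * g x @[x --> F] --> M * N.
Proof.
move=> /cvg_mxpartP fM /cvg_mxpartP gN; apply/cvg_mxpartP => c.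
under eq_fun do rewrite mxpartM; rewrite mxpartM.
apply: cvg_bigsum => a; apply: cvg_bigsum => b.
by apply: cvgM; [exact: cvg_cst|apply: cvgM].
Qed.

Lemma cvgD_mx T (F : set_system T) {FF : Filter F} (f g : T -> mat) M N :
  f @ F --> M -> g @ F --> N -> f x + g x @[x --> F] --> M + N.
Proof.
move=> /cvg_mxpartP fM /cvg_mxpartP gN; apply/cvg_mxpartP => c.
by under eq_fun do rewrite mxpartD; rewrite mxpartD; apply: cvgD.
Qed.

Lemma cvgB_mx T (F : set_system T) {FF : Filter F} (f g : T -> mat) M N :
  f @ F --> M -> g @ F --> N -> f x - g x @[x --> F] --> M - N.
Proof.
move=> /cvg_mxpartP fM /cvg_mxpartP gN; apply/cvg_mxpartP => c.
by under eq_fun do rewrite mxpartB; rewrite mxpartB; apply: cvgB.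
Qed.

Lemma cvg_mx_unique T (F : set_system T) {FF : ProperFilter F} (f : T -> mat) M
  N :
  f @ F --> M -> f @ F --> N -> M = N.
Proof.
move=> /cvg_mxpartP fM /cvg_mxpartP gN; apply: mxpart_inj => c.
exact: (cvg_unique _ (fM c) (gN c)).
Qed.

Lemma lim_mx T (F : set_system T) {FF : ProperFilter F} (f : T -> mat) M :
  f @ F --> M -> lim (f @ F) = M.
Proof.
move=> h; apply: (cvg_mx_unique _ h).
by apply/cvg_ex; exists M.
Qed.

Lemma l1norm_lim_le T (F : set_system T) {FF : ProperFilter F} (f : T -> mat) M
  K :
  f @ F --> M -> (\forall x \near F, l1norm (f x) <= K) -> l1norm M <= K.
Proof.
move=> /cvg_mxpartP fM h.
have fN : l1norm (f x) @[x --> F] --> l1norm M.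
  by apply: cvg_bigsum => c; apply: cvg_norm.
exact: (@closed_cvg _ _ F _ (l1norm \o f) [set r | r <= K] (@closed_le _ K) h _
  fN).
Qed.

(** The variable is real and the entries are complex, so the derivative is taken over the reals in
    each component. *)
Definition mx_derive (f : R -> mat) (u : R) (D : mat) :=
  forall c, is_derive u 1 (fun s => mxpart c (f s)) (mxpart c D).

Lemma mx_derive_cst M u : mx_derive (fun=> M) u 0.
Proof. by move=> c; rewrite mxpart0; exact: is_derive_cst. Qed.

Lemma mx_deriveD f g (u : R) D E :
  mx_derive f u D -> mx_derive g u E -> mx_derive (fun s => f s + g s) u (D +
    E).
Proof.
move=> df dg c; rewrite mxpartD; under eq_fun do rewrite mxpartD.
by have := df c; have := dg c; move=> ? ?; exact: is_deriveD.
Qed.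

Lemma mx_deriveB f g (u : R) D E :
  mx_derive f u D -> mx_derive g u E -> mx_derive (fun s => f s - g s) u (D -
    E).
Proof.
move=> df dg c; rewrite mxpartB; under eq_fun do rewrite mxpartB.
by have := df c; have := dg c; move=> ? ?; exact: is_deriveB.
Qed.

Lemma is_derive_bigsum I (s : seq I) (h : I -> R -> R) (dh : I -> R) (u : R) :
  (forall i, is_derive u 1 (h i) (dh i)) ->
  is_derive u 1 (fun y => \sum_(i <- s) h i y) (\sum_(i <- s) dh i).
Proof.
move=> H; elim: s => [|i s IH].
  by rewrite big_nil; under eq_fun do rewrite big_nil; exact: is_derive_cst.
rewrite big_cons; under eq_fun do rewrite big_cons.
by have := H i => ?; exact: is_deriveD.
Qed.

Lemma mx_deriveM f g (u : R) D E : mx_derive f u D -> mx_derive g u E ->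
  mx_derive (fun s => f s * g s) u (D * g u + f u * E).
Proof.
move=> df dg c; under eq_fun do rewrite mxpartM.
have -> : mxpart c (D * g u + f u * E) = \sum_a \sum_b (cst_struct c a b *:
    (mxpart a (f u) *: mxpart b E + mxpart b (g u) *: mxpart a D)).
  rewrite mxpartD !mxpartM -big_split; apply: eq_bigr => a _;
    rewrite -big_split.
  by apply: eq_bigr => b _ /=; rewrite /GRing.scale /=; ring.
apply: is_derive_bigsum => a; apply: is_derive_bigsum => b.
have := df a; have := dg b => ? ?.
by apply: is_deriveZ; exact: is_deriveM.
Qed.

Lemma mx_deriveMr f (u : R) D M : mx_derive f u D ->
  mx_derive (fun s => f s * M) u (D * M).
Proof. by move=> h; have := mx_deriveM h (mx_derive_cst M u);
  rewrite mulr0 addr0. Qed.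

Lemma mx_deriveMl f (u : R) D M : mx_derive f u D ->
  mx_derive (fun s => M * f s) u (M * D).
Proof. by move=> h; have := mx_deriveM (mx_derive_cst M u) h;
  rewrite mul0r add0r. Qed.

Lemma mx_deriveZ (h : R -> R) (d : R) f (u : R) D : is_derive u 1 h d ->
  mx_derive f u D ->
  mx_derive (fun s => (h s)%:C%C *: f s) u (d%:C%C *: f u + (h u)%:C%C *: D).
Proof.
move=> dh df c; under eq_fun do rewrite mxpartZ; rewrite mxpartD !mxpartZ.
have := df c => ?.
have -> : d * mxpart c (f u) + h u * mxpart c D = h u *: mxpart c D + mxpart c
  (f u) *: d.
  by rewrite /GRing.scale /=; ring.
exact: is_deriveM.
Qed.

Lemma mx_derive_comp (h : R -> R) (d : R) f (u : R) D : is_derive u 1 h d ->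
  mx_derive f (h u) D -> mx_derive (f \o h) u (d%:C%C *: D).
Proof.
move=> dh df c; rewrite mxpartZ mulrC; have := df c => ?.
exact: (@is_derive1_comp _ (fun s => mxpart c (f s)) h).
Qed.

Lemma mx_derive_eq f (u : R) D E : mx_derive f u D -> D = E -> mx_derive f u E.
Proof. by move=> + <-. Qed.

Lemma near_mx_derive f g (u : R) D : (\forall s \near u, f s = g s) ->
  mx_derive f u D -> mx_derive g u D.
Proof.
move=> fg df c; have := df c; apply: near_eq_is_derive.
by apply: filterS fg => s ->.
Qed.

Lemma mx_derive_continuous f (u : R) D : mx_derive f u D ->
  f s @[s --> u] --> f u.
Proof.
move=> df; apply/cvg_mxpartP => c; have [dc _] := df c.
by apply: differentiable_continuous; exact/derivable1_diffP.
Qed.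

End RealComponents.

(** * Power series and the matrix exponential *)

Section RealPowerSeries.
Variable R : realType.
Implicit Types (c : nat -> R) (r s K : R).

(** Abel's lemma: comparison with the geometric series of ratio [|s| / r]. *)
Lemma pseries_bounded_cvg c r s K :
  (forall l, `|c l| * r ^+ l <= K) -> `|s| < r -> cvgn (pseries c s).
Proof.
move=> cK sr; have r0 : 0 < r by apply: le_lt_trans sr.
have K0 : 0 <= K by have := cK 0%N; rewrite expr0 mulr1; apply: le_trans.
apply: normed_cvg; rewrite /normed_series_of /=.
have sr1 : `|s| / r < 1 by rewrite ltr_pdivrMr// mul1r.
apply: (@series_le_cvg _ _ (geometric K (`|s| / r))).
- by move=> l.
- by move=> l; rewrite /geometric /= mulr_ge0// exprn_ge0// divr_ge0// ltW.
- move=> l; rewrite /geometric /= normrM normrX expr_div_n.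
  rewrite mulrA ler_pdivlMr ?exprn_gt0// mulrAC ler_wpM2r//.
- apply: is_cvg_geometric_series.
  by rewrite ger0_norm// divr_ge0// ltW.
Qed.

(** Each of the [l + 1] powers [q ^+ i] with [i <= l] is at least [q ^+ l], so the left-hand side is
    below a partial geometric sum. *)
Lemma natrX_le (q : R) l : 0 <= q < 1 -> l.+1%:R * q ^+ l <= (1 - q)^-1.
Proof.
move=> /andP[q0 q1]; have d0 : 0 < 1 - q by rewrite subr_gt0.
rewrite -[leRHS]mul1r ler_pdivlMr//.
apply: (@le_trans _ _ (1 - q ^+ l.+1)); last by rewrite gerBl exprn_ge0.
have -> : 1 - q ^+ l.+1 = (1 - q) * \sum_(i < l.+1) q ^+ i.
  by rewrite -[LHS]opprB subrX1 -mulNr opprB.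
rewrite [leLHS]mulrC ler_wpM2l ?(ltW d0)//.
rewrite mulr_natl -[X in _ *+ X]card_ord -sumr_const.
apply: ler_sum => i _; apply: ler_wiXn2l => //; first exact: ltW.
by rewrite -ltnS.
Qed.

Lemma pseries_diffs_bounded c r s K : 0 <= s < r ->
  (forall l, `|c l| * r ^+ l <= K) ->
  exists K', forall l, `|pseries_diffs c l| * s ^+ l <= K'.
Proof.
move=> /andP[s0 sr] cK; have r0 : 0 < r by apply: le_lt_trans sr.
have K0 : 0 <= K by have := cK 0%N; rewrite expr0 mulr1; apply: le_trans.
exists (K / r * (1 - s / r)^-1) => l.
have : l.+1%:R * (s / r) ^+ l <= (1 - s / r)^-1.
  by apply: natrX_le; rewrite divr_ge0 ?(ltW r0)//= ltr_pdivrMr// mul1r.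
move=> h; rewrite /pseries_diffs normrM normr_nat.
have -> : l.+1%:R * `|c l.+1| * s ^+ l =
    (`|c l.+1| * r ^+ l.+1) / r * (l.+1%:R * (s / r) ^+ l).
  have rl : r ^+ l != 0 by rewrite expf_neq0// gt_eqF.
  by rewrite expr_div_n exprS; field; rewrite rl gt_eqF.
apply: ler_pM => //.
- by rewrite divr_ge0 ?mulr_ge0 ?exprn_ge0// ltW.
- by rewrite mulr_ge0// exprn_ge0// divr_ge0// ltW.
- by rewrite ler_pM2r ?invr_gt0.
Qed.

Lemma pseries_bounded_derive c r s K :
  (forall l, `|c l| * r ^+ l <= K) -> `|s| < r ->
  is_derive s (1 : R) (fun x => limn (pseries c x))
    (limn (pseries (pseries_diffs c) s)).
Proof.
(* Each termwise differentiation costs some radius: [|s| < r1 < r3 < r2 < r], where [r2] serves the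
   first differences, [r3] the second ones, and all three series converge at [r1]. *)
move=> cK sr; pose r3 := (`|s| + r) / 2; pose r2 := (r3 + r) / 2.
pose r1 := (`|s| + r3) / 2.
have s0 : 0 <= `|s| by [].
have [K2 cK2] : exists K', forall l, `|pseries_diffs c l| * r2 ^+ l <= K'.
  by apply: pseries_diffs_bounded cK; rewrite /r2 /r3; lra.
have [K3 cK3] : exists K', forall l,
    `|pseries_diffs (pseries_diffs c) l| * r3 ^+ l <= K'.
  by apply: pseries_diffs_bounded cK2; rewrite /r2 /r3; lra.
have r10 : 0 <= r1 by rewrite /r1 /r3; lra.
apply: (@pseries_snd_diffs _ c r1).
- by apply: pseries_bounded_cvg cK _; rewrite (ger0_norm r10) /r1 /r3; lra.
- by apply: pseries_bounded_cvg cK2 _; rewrite (ger0_norm r10) /r1 /r2 /r3; lra.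
- by apply: pseries_bounded_cvg cK3 _; rewrite (ger0_norm r10) /r1 /r3; lra.
- by rewrite (ger0_norm r10) /r1 /r3; lra.
Qed.

Lemma expR_geXn (y : R) l : 0 <= y -> y ^+ l / l`!%:R <= expR y.
Proof.
move=> y0; case: l => [|l].
  by rewrite fact0 expr0 divr1 -expR0 ler_expR.
by have := expR_ge1Dxn l y0; lra.
Qed.

End RealPowerSeries.

Section MatrixPowerSeries.
Variables (R : realType) (n : nat).
Local Notation mat := 'M[R[i]]_n.+1.
Implicit Types (M N : mat) (a : nat -> mat) (r s K : R).

Definition mx_pseries a s : nat -> mat :=
  series (fun l => (s ^+ l)%:C%C *: a l).

Definition mx_diffs a l : mat := (l.+1%:R : R)%:C%C *: a l.+1.

Lemma mxpart_pseries a s (m : nat) (c : 'I_n.+1 * 'I_n.+1 * bool) :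
  mxpart c (mx_pseries a s m) = pseries (fun l => mxpart c (a l)) s m.
Proof.
rewrite /mx_pseries /pseries /series /= mxpart_sum.
by apply: eq_bigr => l _; rewrite mxpartZ mulrC.
Qed.

Lemma mx_pseries_cvg a r s K : (forall l, l1norm (a l) * r ^+ l <= K) -> `|s| <
  r ->
  mx_pseries a s @ \oo --> limn (mx_pseries a s).
Proof.
move=> aK sr; have r0 : 0 < r by apply: le_lt_trans sr.
pose L c := limn (pseries (fun l => mxpart c (a l)) s).
apply/cvg_ex; exists (\matrix_(i, j) Complex (L (i, j, true)) (L (i, j,
  false))).
apply/cvg_mxpartP => c; under eq_fun do rewrite mxpart_pseries.
have -> : mxpart c (\matrix_(i, j) Complex (L (i, j, true)) (L (i, j, false)))
  = L c.
  by case: c => -[i j] []; rewrite /mxpart /cpart /= mxE.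
apply: (@pseries_bounded_cvg _ _ r _ K) => // l.
by rewrite (le_trans _ (aK l))// ler_wpM2r ?mxpart_le_l1norm// exprn_ge0// ltW.
Qed.

Lemma mx_diffs_bounded a r s K : 0 <= s < r ->
  (forall l, l1norm (a l) * r ^+ l <= K) ->
  exists K', forall l, l1norm (mx_diffs a l) * s ^+ l <= K'.
Proof.
move=> sr aK; have /andP[s0 sr'] := sr; have r0 : 0 < r := le_lt_trans s0 sr'.
(* The existential is made informative so that the bounds of all components can be summed. *)
have h (c : 'I_n.+1 * 'I_n.+1 * bool) : {K' | forall l,
    `|pseries_diffs (fun l => mxpart c (a l)) l| * s ^+ l <= K'}.
  apply: cid; apply: (@pseries_diffs_bounded _ _ r _ K) => // l.
  by rewrite (le_trans _ (aK l))// ler_wpM2r ?mxpart_le_l1norm// exprn_ge0//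
    ltW.
exists (\sum_c sval (h c)) => l; rewrite /l1norm mulr_suml;
  apply: ler_sum => c _.
by rewrite mxpartZ; exact: (svalP (h c) l).
Qed.

Lemma mx_pseries_derive a r s K :
  (forall l, l1norm (a l) * r ^+ l <= K) -> `|s| < r ->
  mx_pseries (mx_diffs a) s @ \oo --> limn (mx_pseries (mx_diffs a) s) /\
  mx_derive (fun x => limn (mx_pseries a x)) s (limn (mx_pseries (mx_diffs a)
    s)).
Proof.
move=> aK sr; pose r1 := (`|s| + r) / 2.
have s0 : 0 <= `|s| by [].
have sr1 : `|s| < r1 by rewrite /r1; lra.
have r0 : 0 < r by apply: le_lt_trans sr.
have cK c l : `|mxpart c (a l)| * r ^+ l <= K.
  by rewrite (le_trans _ (aK l))// ler_wpM2r ?mxpart_le_l1norm// exprn_ge0//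
    ltW.
have [|K' aK'] := @mx_diffs_bounded a r r1 K _ aK; first by rewrite /r1; lra.
have dcvg := mx_pseries_cvg aK' sr1; split => //.
move=> c; have /cvg_mxpartP/(_ c)/cvg_lim <- := dcvg => //.
have -> : (fun m => mxpart c (mx_pseries (mx_diffs a) s m)) =
    pseries (pseries_diffs (fun l => mxpart c (a l))) s.
  apply/funext => m; rewrite mxpart_pseries; congr (pseries _ s m).
  by apply/funext => l; rewrite mxpartZ.
have := pseries_bounded_derive (cK c) sr; apply: near_eq_is_derive.
have : \forall x \near s, `|x| < r.
  exact: (cvgr_lt `|s| (@norm_continuous _ R s) r sr).
apply: filterS => x xr; apply/esym.
have /cvg_mxpartP/(_ c)/cvg_lim <- := mx_pseries_cvg aK xr => //.
by congr (limn _); apply/funext => l; rewrite mxpart_pseries.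
Qed.

End MatrixPowerSeries.

Section Exponential.
Variables (R : realType) (n : nat).
Local Notation mat := 'M[R[i]]_n.+1.
Implicit Types (M N : mat) (r s : R).

Definition exp_coef M l : mat := (l`!%:R : R[i])^-1 *: M ^+ l.

Lemma natC (l : nat) : (l%:R : R[i]) = (l%:R : R)%:C%C.
Proof. by rewrite rmorph_nat. Qed.

Lemma exp_coefE M l : exp_coef M l = ((l`!%:R : R)^-1)%:C%C *: M ^+ l.
Proof. by rewrite /exp_coef natC fmorphV. Qed.

Lemma exp_coef_bound M r l : 0 <= r ->
  l1norm (exp_coef M l) * r ^+ l <= l1norm (1 : mat) * expR (l1norm M * r).
Proof.
move=> r0; rewrite exp_coefE l1normZ ger0_norm ?invr_ge0//.
apply: (@le_trans _ _ (l1norm (1 : mat) * ((l1norm M * r) ^+ l / l`!%:R))).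
  have -> : l1norm (1 : mat) * ((l1norm M * r) ^+ l / l`!%:R) =
      l1norm (1 : mat) * l1norm M ^+ l * (r ^+ l / l`!%:R) by rewrite exprMn;
        ring.
  have -> : (l`!%:R)^-1 * l1norm (M ^+ l) * r ^+ l = l1norm (M ^+ l) * (r ^+ l
    / l`!%:R).
    by ring.
  by rewrite ler_wpM2r ?l1normX// divr_ge0// exprn_ge0.
by rewrite ler_wpM2l ?l1norm_ge0// expR_geXn// mulr_ge0// l1norm_ge0.
Qed.

Lemma mx_expE M s : mx_exp (s%:C%C *: M) = limn (mx_pseries (exp_coef M) s).
Proof.
rewrite /mx_exp /mx_pseries; congr (limn (series _)); apply/funext => l.
by rewrite /exp_coef exprZn rmorphXn !scalerA mulrC.
Qed.

Lemma mx_exp_cvg M : series (exp_coef M) @ \oo --> mx_exp M.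
Proof.
have h1 : `|1 : R| < 2 by rewrite normr1 ltr1n.
have := mx_pseries_cvg (fun l => @exp_coef_bound M 2 l (ler0n _ 2)) h1.
rewrite -mx_expE scale1r /mx_pseries.
by under [X in series X]eq_fun do rewrite expr1n scale1r.
Qed.

Lemma mx_exp_derive M s :
  mx_derive (fun s => mx_exp (s%:C%C *: M)) s (M * mx_exp (s%:C%C *: M)).
Proof.
have r0 : 0 <= `|s| + 1 by rewrite addr_ge0.
have sr : `|s| < `|s| + 1 by rewrite ltrDl.
have [dc] := mx_pseries_derive (fun l => @exp_coef_bound M _ l r0) sr.
under eq_fun do rewrite -mx_expE.
move=> dE; apply: (mx_derive_eq dE).
apply: cvg_mx_unique dc _.
have h : M * mx_pseries (exp_coef M) s l @[l --> \oo] --> M * mx_exp (s%:C%C *: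
  M).
  rewrite mx_expE; apply: cvgM_mx; first exact: cvg_cst.
  exact: mx_pseries_cvg (fun l => @exp_coef_bound M _ l r0) sr.
suff -> : mx_pseries (mx_diffs (exp_coef M)) s =
  (fun m => M * mx_pseries (exp_coef M) s m) by exact: h.
apply/funext => m.
rewrite /mx_pseries /series /= mulr_sumr; apply: eq_bigr => l _.
rewrite /mx_diffs !exp_coefE !scalerA -scalerAr exprS -!rmorphM /=.
congr (_%:C%C *: _); rewrite factS natrM invfM; field.
by rewrite nat1r !pnatr_eq0 -lt0n fact_gt0.
Qed.

Lemma mx_exp0 : mx_exp (0 : mat) = 1.
Proof.
have h : series (exp_coef (0 : mat)) @ \oo --> (1 : mat); last first.
  exact: cvg_mx_unique (@mx_exp_cvg 0) h.
apply: cvg_near_cst; exists 1%N => // N /= N0.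
rewrite /series /= (big_cat_nat _ N0)//= big_nat1 big_nat_cond big1 => [|l].
  by rewrite /exp_coef fact0 expr0 invr1 scale1r addr0.
by rewrite andbT => /andP[l0 _]; rewrite /exp_coef expr0n gtn_eqF// scaler0.
Qed.

Lemma comm_mx_exp M N : GRing.comm N M -> GRing.comm N (mx_exp M).
Proof.
move=> NM.
have h1 : N * series (exp_coef M) l @[l --> \oo] --> N * mx_exp M.
  by apply: cvgM_mx (@mx_exp_cvg M); exact: cvg_cst.
have h2 : series (exp_coef M) l * N @[l --> \oo] --> mx_exp M * N.
  by apply: cvgM_mx (@mx_exp_cvg M) _; exact: cvg_cst.
suff E : (fun l => N * series (exp_coef M) l) = (fun l => series (exp_coef M) l
  * N).
  by rewrite E in h1; apply: cvg_mx_unique h1 h2.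
apply/funext => l; rewrite /series /= mulr_suml mulr_sumr;
  apply: eq_bigr => k _.
by rewrite /exp_coef -scalerAl -scalerAr; congr (_ *: _); exact/commrX.
Qed.

Lemma mx_derive0_cst (f : R -> mat) : (forall u, mx_derive f u 0) ->
  forall u, f u = f 0.
Proof.
move=> df u; apply: mxpart_inj => c.
apply: (@is_derive_0_is_cst _ (fun s => mxpart c (f s))) => x.
by have := df x c; rewrite mxpart0.
Qed.

Lemma mx_exp_derivN M s : mx_derive (fun s => mx_exp ((- s)%:C%C *: M)) s
  (- (M * mx_exp ((- s)%:C%C *: M))).
Proof.
have h := mx_derive_comp (is_deriveNid s 1) (@mx_exp_derive M (- s)).
apply: mx_derive_eq h _.
by rewrite rmorphN scaleNr scale1r.
Qed.

(* [exp (- s M) * Y s] has derivative [0]. *)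
Lemma mx_exp_unique M (Y : R -> mat) : Y 0 = 1 ->
  (forall s, mx_derive Y s (M * Y s)) -> forall s, Y s = mx_exp (s%:C%C *: M).
Proof.
move=> Y0 dY.
have inv (Z : R -> mat) : Z 0 = 1 -> (forall s, mx_derive Z s (M * Z s)) ->
    forall s, mx_exp ((- s)%:C%C *: M) * Z s = 1.
  move=> Z0 dZ s.
  pose f s := mx_exp ((- s)%:C%C *: M) * Z s.
  rewrite -/(f s) (@mx_derive0_cst f).
    by rewrite /f oppr0 scale0r mx_exp0 Z0 mulr1.
  move=> u; apply: mx_derive_eq (mx_deriveM (mx_exp_derivN M u) (dZ u)) _.
  rewrite mulNr mulrA -[_ * M]comm_mx_exp ?addNr//.
  by rewrite /GRing.comm -scalerAl -scalerAr.
(* Both [Y s] and the exponential are right inverses of [mx_exp ((- s)%:C%C *: M)], which is a unit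
   and can be cancelled. *)
move=> s; have h1 := inv _ Y0 dY s.
have h2 : mx_exp ((- s)%:C%C *: M) * mx_exp (s%:C%C *: M) = 1.
  apply: (inv (fun s => mx_exp (s%:C%C *: M)));
    first by rewrite scale0r mx_exp0.
  exact: mx_exp_derive.
have [h3 _] := mulmx1_unit h2.
by apply: (@mulrI _ _ h3); rewrite h1 h2.
Qed.

(** The product of the two exponentials solves [Y' = (M + N) Y] with [Y 0 = 1]; commutation moves
    [N] past the exponential of [M]. *)
Lemma mx_expD M N : GRing.comm M N -> mx_exp (M + N) = mx_exp M * mx_exp N.
Proof.
move=> MN.
have := @mx_exp_unique (M + N)
  (fun s => mx_exp (s%:C%C *: M) * mx_exp (s%:C%C *: N)) _ _ 1.
rewrite !scale1r => -> //.
  by rewrite !scale0r !mx_exp0 mulr1.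
move=> s.
apply: mx_derive_eq (mx_deriveM (mx_exp_derive M s) (mx_exp_derive N s)) _.
rewrite mulrDl !mulrA; congr (_ + _ * _).
by apply/esym/comm_mx_exp; rewrite /GRing.comm -scalerAl -scalerAr MN.
Qed.

Lemma mx_exp_realE (r : R) : mx_exp (r%:C%C *: (1 : mat)) = (expR r)%:C%C *: 1.
Proof.
apply/esym/(@mx_exp_unique (1 : mat) (fun s => (expR s)%:C%C *: 1)).
  by rewrite expR0 scale1r.
move=> s.
apply: mx_derive_eq (mx_deriveZ (is_derive_expR s) (@mx_derive_cst _ _ (1 :
  mat) s)) _.
by rewrite scaler0 addr0 mul1r.
Qed.

End Exponential.

(** * Growth of the matrix exponential *)

Section ExponentialBound.
Variables (R : realType) (n : nat).
Local Notation mat := 'M[R[i]]_n.+1.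
Implicit Types (M N : mat) (r s K : R).

Lemma is_derive_nincr (f df : R -> R) s : 0 <= s ->
  (forall u, is_derive u (1 : R) f (df u)) -> (forall u, 0 <= u -> df u <= 0) ->
  f s <= f 0.
Proof.
move=> s0 fd f0.
apply: (@ler0_derive1_le_cc _ f 0 s); rewrite ?in_itv/= ?lexx ?s0//.
- move=> u; rewrite in_itv/= => /andP[u0 _].
  by rewrite derive1E; have [_ ->] := fd u; apply: f0; apply: ltW.
- apply: continuous_subspaceT => u; apply: differentiable_continuous.
  by apply/derivable1_diffP; have [] := fd u.
Qed.

(* The energy [x^2 + y^2] decays at rate [- al], up to the forcing terms. *)
Lemma damped_bounded (x y f1 f2 : R -> R) (al be K : R) : al < 0 ->
  (forall s, is_derive s (1 : R) x (al * x s - be * y s + f1 s)) ->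
  (forall s, is_derive s (1 : R) y (be * x s + al * y s + f2 s)) ->
  (forall s, 0 <= s -> `|f1 s| <= K) -> (forall s, 0 <= s -> `|f2 s| <= K) ->
  exists C, forall s, 0 <= s -> `|x s| + `|y s| <= C.
Proof.
move=> al0 dx dy bf1 bf2; pose mu := - al;
  have mu0 : 0 < mu by rewrite oppr_gt0.
(* The rotation by [be] does not change the energy [N]. From [2 z f <= mu z^2 + f^2 / mu] one gets
   [N' <= - mu N + 2 K^2 / mu = - mu (N - c)], so [expR (mu * s) * (N s - c)] does not increase. *)
pose c := 2 * K ^+ 2 / mu ^+ 2; pose N s := x s ^+ 2 + y s ^+ 2.
have K0 : 0 <= K := le_trans (normr_ge0 _) (bf1 0 (lexx 0)).
have c0 : 0 <= c by apply: divr_ge0; rewrite ?sqr_ge0// pmulr_rge0// sqr_ge0.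
pose V s := expR (mu * s) * (N s - c).
pose dV s := expR (mu * s) * (mu * (N s - c) + 2 * (x s * (al * x s - be * y s
  + f1 s) +
   y s * (be * x s + al * y s + f2 s))).
have VdV u : is_derive u (1 : R) V (dV u).
  have ? := dx u; have ? := dy u.
  rewrite /V /N; apply: is_derive_eq.
  rewrite /dV /N /GRing.scale /=; ring.
have V0 s : 0 <= s -> V s <= V 0.
  move=> s0; apply: (is_derive_nincr s0 VdV) => u u0.
  rewrite /dV pmulr_rle0 ?expR_gt0//.
  have sq (f : R) : `|f| <= K -> f ^+ 2 <= K ^+ 2.
    by move=> fK; rewrite -real_normK ?num_real// ler_sqr ?nnegrE.
  have h1 := sq _ (bf1 u u0); have h2 := sq _ (bf2 u u0).
  have am (z f : R) : 2 * (z * f) <= mu * z ^+ 2 + f ^+ 2 / mu.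
    rewrite -subr_ge0.
    have -> : mu * z ^+ 2 + f ^+ 2 / mu - 2 * (z * f) = mu * (z - f / mu) ^+ 2.
      by field; rewrite gt_eqF.
    by rewrite mulr_ge0 ?sqr_ge0// ltW.
  have a1 := am (x u) (f1 u); have a2 := am (y u) (f2 u).
  have e1 : f1 u ^+ 2 / mu + f2 u ^+ 2 / mu <= mu * c.
    have -> : mu * c = (K ^+ 2 + K ^+ 2) / mu.
      by rewrite /c; field; rewrite gt_eqF.
    by rewrite -mulrDl ler_pM2r ?invr_gt0// lerD.
  rewrite /N /mu in a1 a2 e1 *.
  rewrite (_ : _ + _ = - al * (x u ^+ 2 + y u ^+ 2 - c) + 2 * al * (x u ^+ 2 +
    y u ^+ 2)
     + (2 * (x u * f1 u) + 2 * (y u * f2 u))); last by ring.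
  by lra.
have N0 s : 0 <= N s by rewrite addr_ge0 ?sqr_ge0.
have Nb s : 0 <= s -> N s <= N 0 + c.
  move=> s0; have := V0 s s0; rewrite /V mulr0 expR0 mul1r => h.
  have e1 : 1 <= expR (mu * s) by rewrite -expR0 ler_expR mulr_ge0// ltW.
  have [h1|h1] := leP (N s - c) 0; first by have := N0 0; lra.
  have h2 : N s - c <= expR (mu * s) * (N s - c) by rewrite ler_peMl// ltW.
  lra.
exists (2 * (1 + (N 0 + c))) => s s0; have := Nb s s0.
have sqb (z : R) : `|z| <= 1 + z ^+ 2.
  have := sqr_ge0 (`|z| - 1); rewrite sqrrB real_normK ?num_real// mulr1 expr1n.
  by have := normr_ge0 z; lra.
rewrite {1}/N; have := sqb (x s); have := sqb (y s); have := sqr_ge0 (x s);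
  have := sqr_ge0 (y s).
lra.
Qed.

Definition l1norm_bounded (Y : R -> mat) := exists K, forall s, 0 <= s ->
  l1norm (Y s) <= K.

(** Writing [M Y = lam Y + (M - lam) Y] makes each entry of [Y] a damped planar system with a
    bounded forcing term. *)
Lemma solution_bounded_step M (lam : R[i]) (Y : R -> mat) : complex.Re lam < 0
  ->
  (forall s, mx_derive Y s (M * Y s)) ->
  l1norm_bounded (fun s => (M - lam%:M) * Y s) -> l1norm_bounded Y.
Proof.
move=> l0 dY [K bK].
have H (ij : 'I_n.+1 * 'I_n.+1) : {C | forall s, 0 <= s ->
    `|complex.Re (Y s ij.1 ij.2)| + `|complex.Im (Y s ij.1 ij.2)| <= C}.
  apply: cid; case: ij => i j /=.
  pose f b s := mxpart (i, j, b) ((M - lam%:M) * Y s).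
  have MYE s : (M * Y s) i j = lam * Y s i j + ((M - lam%:M) * Y s) i j.
    rewrite mulrBl (mul_scalar_mx lam (Y s) : lam%:M * Y s = _).
    by rewrite [X in _ + X]mxE [X in _ + (_ + X)]mxE [X in _ - X]mxE addrC
      subrK.
  apply: (@damped_bounded (fun s => mxpart (i, j, true) (Y s))
     (fun s => mxpart (i, j, false) (Y s)) (f true) (f false)
     (complex.Re lam) (complex.Im lam) K) => //.
  - move=> s; apply: is_derive_eq (dY s (i, j, true)) _.
    rewrite /mxpart /f /mxpart /cpart /= MYE.
    by case: (lam) (Y s i j) => a b [a' b'] /=; case: (_ i j) => a'' b'' /=;
      ring.
  - move=> s; apply: is_derive_eq (dY s (i, j, false)) _.
    rewrite /mxpart /f /mxpart /cpart /= MYE.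
    by case: (lam) (Y s i j) => a b [a' b'] /=; case: (_ i j) => a'' b'' /=;
      ring.
  - by move=> s s0; rewrite (le_trans (mxpart_le_l1norm _ _)) ?bK.
  - by move=> s s0; rewrite (le_trans (mxpart_le_l1norm _ _)) ?bK.
exists (\sum_i \sum_j sval (H (i, j))) => s s0; rewrite l1normE.
apply: ler_sum => i _; apply: ler_sum => j _; exact: (svalP (H (i, j)) s s0).
Qed.

(** The factors are peeled off one at a time: since they commute with [M], every partial product
    applied to [Y] solves the same equation, and the previous lemma removes its leading factor. With
    an annihilating product the hypothesis becomes trivial. *)
Lemma solution_bounded M (rs : seq R[i]) (Y : R -> mat) :
  (forall lam, lam \in rs -> complex.Re lam < 0) ->
  (forall s, mx_derive Y s (M * Y s)) ->
  l1norm_bounded (fun s => (\prod_(lam <- rs) (M - lam%:M)) * Y s) ->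
    l1norm_bounded Y.
Proof.
elim: rs Y => [|lam rs IH] Y rs0 dY.
  by under eq_fun do rewrite big_nil mul1r.
under eq_fun do rewrite big_cons -mulrA.
move=> h; apply: IH => //; first by move=> r rrs; apply: rs0;
  rewrite inE rrs orbT.
apply: solution_bounded_step h; first by apply: rs0; rewrite inE eqxx.
move=> s; apply: mx_derive_eq (mx_deriveMl _ (dY s)) _.
rewrite !mulrA; congr (_ * _); apply/commr_sym/commr_prod => r _.
apply: commrB => //; exact: scalar_mxC.
Qed.

(** Cayley-Hamilton with the characteristic polynomial split into linear factors; it takes the place
    of a Jordan form. *)
Lemma eigenvalue_seq M : exists rs : seq R[i],
  (forall lam, eigenvalue M lam -> lam \in rs) /\
  \prod_(lam <- rs) (M - lam%:M) = 0 /\ (forall lam, lam \in rs -> eigenvalue M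
    lam).
Proof.
have [rs Ers] := closed_field_poly_normal (char_poly M).
move: Ers; rewrite (monicP (char_poly_monic M)) scale1r => Ers.
exists rs; split; [|split].
- by move=> lam; rewrite eigenvalue_root_char Ers root_prod_XsubC.
- have := Cayley_Hamilton M; rewrite Ers rmorph_prod /= => <-.
  by apply: eq_bigr => lam _; rewrite rmorphB /= horner_mx_X horner_mx_C.
- by move=> lam; rewrite eigenvalue_root_char Ers root_prod_XsubC.
Qed.

Lemma mx_exp_bounded M : (forall lam, eigenvalue M lam -> complex.Re lam < 0) ->
  l1norm_bounded (fun s => mx_exp (s%:C%C *: M)).
Proof.
move=> eM; have [rs [_ [rs0 rsM]]] := eigenvalue_seq M.
apply: (@solution_bounded M rs).
- by move=> lam /rsM /eM.
- by move=> s; exact: mx_exp_derive.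
- by rewrite rs0; exists 0 => s _; rewrite mul0r l1norm0.
Qed.

(** Subtracting [a] from [M] shifts the spectrum into the open left half-plane, where the
    exponential is bounded. *)
Lemma mx_exp_bound M (a : R) :
  (forall lam, eigenvalue M lam -> complex.Re lam < a) ->
  exists K, forall s, 0 <= s -> l1norm (mx_exp (s%:C%C *: M)) <= K * expR (a *
    s).
Proof.
move=> eM; pose M' := M - a%:C%C *: 1.
have [|K bK] := @mx_exp_bounded M'.
  move=> lam /eigenvalueP[v vM v0].
  have : eigenvalue M (lam + a%:C%C).
    apply/eigenvalueP; exists v => //; rewrite scalerDl -vM mulmxBr.
    by rewrite -scalemxAr mulmx1 subrK.
  by move/eM; case: (lam) => b c /=; rewrite gtrDr.
exists K => s s0.
have -> : s%:C%C *: M = s%:C%C *: M' + (a * s)%:C%C *: 1.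
  by rewrite /M' scalerBr scalerA -rmorphM mulrC subrK.
rewrite mx_expD; last first.
  by rewrite /GRing.comm -scalerAr mulr1 -[in RHS]scalerAl mul1r.
rewrite mx_exp_realE -scalerAr mulr1 l1normZ ger0_norm ?expR_ge0// mulrC.
by rewrite ler_wpM2r ?expR_ge0 ?bK.
Qed.

End ExponentialBound.

(** * Powers of positive reals with matrix exponents *)

Section MatrixPowers.
Variables (R : realType) (n : nat).
Local Notation mat := 'M[R[i]]_n.+1.
Implicit Types (M N P Q : mat) (u v t : R).

Lemma mx_pow_derive M u : 0 < u ->
  mx_derive (fun s => mx_pow s M) u ((u^-1)%:C%C *: (M * mx_pow u M)).
Proof.
by move=> u0; exact: mx_derive_comp (is_derive1_ln u0) (@mx_exp_derive _ _ M
  (ln u)).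
Qed.

Lemma comm_scale (a b : R[i]) M N : GRing.comm M N -> GRing.comm (a *: M) (b *:
  N).
Proof. by move=> h; rewrite /GRing.comm -!scalerAl -!scalerAr h scalerA mulrC
  -scalerA. Qed.

Lemma commr_scale (a : R[i]) M N : GRing.comm M N -> GRing.comm M (a *: N).
Proof. by move=> h; rewrite -[M]scale1r; exact: comm_scale. Qed.

Lemma comm_mx_pow M N u : GRing.comm N M -> GRing.comm N (mx_pow u M).
Proof.
by move=> h; apply: comm_mx_exp; rewrite -[N]scale1r; exact: comm_scale.
Qed.

Lemma mx_powD M N u : GRing.comm M N ->
  mx_pow u (M + N) = mx_pow u M * mx_pow u N.
Proof. by move=> h; rewrite /mx_pow scalerDr mx_expD//; exact: comm_scale. Qed.

Lemma mx_powM M u v : 0 < u -> 0 < v ->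
  mx_pow (u * v) M = mx_pow u M * mx_pow v M.
Proof.
move=> u0 v0; rewrite /mx_pow (lnM u0 v0) rmorphD scalerDl mx_expD; first by [].
exact: comm_scale.
Qed.

Lemma mx_pow1r u : 0 < u -> mx_pow u 1 = u%:C%C *: (1 : mat).
Proof. by move=> u0; rewrite /mx_pow mx_exp_realE lnK ?posrE. Qed.

Lemma mx_powS M u : 0 < u -> mx_pow u (M + 1) = u%:C%C *: mx_pow u M.
Proof.
move=> u0; rewrite mx_powD ?mx_pow1r -?scalerAr ?mulr1//.
exact: commr1.
Qed.

Lemma mx_powB1 M u : 0 < u -> mx_pow u (M - 1) = (u^-1)%:C%C *: mx_pow u M.
Proof.
move=> u0; rewrite -[in RHS](subrK 1 M) mx_powS// scalerA -rmorphM.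
by rewrite mulVf ?gt_eqF// scale1r.
Qed.

Lemma mx_powNK M u : mx_pow u M * mx_pow u (- M) = 1.
Proof.
rewrite -mx_powD ?subrr; last by apply/commrN.
by rewrite /mx_pow scaler0 mx_exp0.
Qed.

End MatrixPowers.

(** * Positive stable matrices *)

Section PositiveStable.
Variables (R : realType) (n : nat).
Local Notation mat := 'M[R[i]]_n.+1.
Implicit Types (M N P Q : mat) (u v t : R).

Lemma positive_stable_unit M : positive_stable M -> M \is a GRing.unit.
Proof.
move=> hM; case: (boolP (M \is a GRing.unit)) => // Mu.
have : eigenvalue M 0.
  by rewrite /eigenvalue /eigenspace raddf0 subr0 kermx_eq0 row_free_unit.
by move/hM; rewrite /= ltxx.
Qed.

(** Starting from an eigenvector of [P + Q], the factors [P - lam] of an annihilating product are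
    applied in turn. The last nonzero vector obtained is an eigenvector of [P] and still one of
    [P + Q], hence also of [Q]. *)
Lemma positive_stableD P Q : GRing.comm P Q ->
  positive_stable P -> positive_stable Q -> positive_stable (P + Q).
Proof.
move=> PQ hP hQ lam /eigenvalueP[v vPQ v0].
have [rs [_ [rs0 rsP]]] := eigenvalue_seq P.
suff [mu murs [w wPQ [wP w0]]] : exists2 mu, mu \in rs &
    exists2 w : 'rV[R[i]]_n.+1, w *m (P + Q) = lam *: w & w *m P = mu *: w /\ w
      != 0.
  have : eigenvalue Q (lam - mu).
    apply/eigenvalueP; exists w => //.
    by rewrite scalerBl -wP -wPQ mulmxDr addrC addKr.
  move/hQ; have /hP := rsP _ murs.
  by case: (lam) (mu) => a b [a' b'] /=; lra.
have vrs : v *m \prod_(lam <- rs) (P - lam%:M) = 0 by rewrite rs0 mulmx0.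
elim: rs {rs0 rsP} v vPQ v0 vrs => [|mu rs IH] v vPQ v0.
  by rewrite big_nil mulmx1 => /eqP; rewrite (negPf v0).
rewrite big_cons => vrs.
have [vmu|vmu] := eqVneq (v *m (P - mu%:M)) 0.
  exists mu; first by rewrite inE eqxx.
  exists v => //; split => //; apply/eqP; rewrite -subr_eq0 -vmu.
  by rewrite mulmxBr mul_mx_scalar.
have [||nu nurs H] := IH _ _ vmu.
- rewrite -mulmxA.
  suff -> : (P - mu%:M) *m (P + Q) = (P + Q) *m (P - mu%:M).
    by rewrite mulmxA vPQ scalemxAl.
  apply/commr_sym/commrB; last exact: scalar_mxC.
  by apply/commr_sym/commrD.
- by rewrite -mulmxA.
- by exists nu => //; rewrite inE nurs orbT.
Qed.

Lemma positive_stableDn M j : positive_stable M -> positive_stable (M + j%:R).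
Proof.
move=> hM lam /eigenvalueP[v vM v0].
have : eigenvalue M (lam - j%:R).
  apply/eigenvalueP; exists v => //.
  have jE : j%:R = (j%:R)%:M :> mat by rewrite rmorph_nat.
  by rewrite scalerBl -vM mulmxDr jE mul_mx_scalar addrK.
move/hM; have : (0 : R) <= j%:R by [].
have -> : (j%:R : R[i]) = (j%:R : R)%:C%C by rewrite rmorph_nat.
by case: (lam) => a b /=; lra.
Qed.

(** Finiteness of the spectrum leaves room on both sides. [D] is an integer so that [(1 + v) ^+ D]
    is an ordinary power. *)
Lemma seq_Re_bounds (rs : seq R[i]) : exists d (D : nat), [/\ 0 < d,
  forall lam, lam \in rs -> 0 < complex.Re lam -> d < complex.Re lam &
  forall lam, lam \in rs -> complex.Re lam < D%:R].
Proof.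
elim: rs => [|r rs [d [D [d0 H1 H2]]]]; first by exists 1, 0%N; split.
pose r1 := complex.Re r.
(* Halving makes the lower bound strict; a root with nonpositive real part imposes no condition,
   hence the default 1. *)
exists (Num.min d (if 0 < r1 then r1 / 2 else 1)), (maxn D (Num.bound `|r1|));
  split.
- by rewrite lt_min d0 /=; case: ifP => // ?; rewrite divr_gt0.
- move=> lam; rewrite inE => /orP[/eqP ->|/H1 H] l0.
    by rewrite -/r1 in l0 *; rewrite l0 gt_min; apply/orP; right; lra.
  by rewrite gt_min H.
- move=> lam; rewrite inE => /orP[/eqP ->|/H2 H].
    apply: (@lt_le_trans _ _ (Num.bound `|r1|)%:R);
      last by rewrite ler_nat leq_maxr.
    by apply: (le_lt_trans (ler_norm _)); exact: archi_boundP.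
  by apply: (lt_le_trans H); rewrite ler_nat leq_maxl.
Qed.

(** For [ln v >= 0] the exponential of [M] grows at most like [v^(d + D)]; for [ln v < 0] the
    exponential of [- M] at time [- ln v] decays like [v^d]. The product [v^d (1 + v)^D] dominates
    both. *)
Lemma mx_pow_bound M : positive_stable M -> exists d (D : nat) K,
  [/\ 0 < d, 0 < K & forall v, 0 < v ->
    l1norm (mx_pow v M) <= K * (expR (d * ln v) * (1 + v) ^+ D)].
Proof.
move=> hM; have [rs [eM _]] := eigenvalue_seq M.
have [d [D [d0 rsd rsD]]] := seq_Re_bounds rs.
have [|K1 bK1] := @mx_exp_bound _ _ M (d + D%:R).
  by move=> lam /eM /rsD h; apply: (lt_trans h); rewrite ltrDr.
have [|K2 bK2] := @mx_exp_bound _ _ (- M) (- d).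
  move=> lam /eigenvalueP[w wM w0].
  have eL : eigenvalue M (- lam).
    by apply/eigenvalueP; exists w => //; rewrite scaleNr -wM mulmxN opprK.
  have := rsd _ (eM _ eL) (hM _ eL).
  by case: (lam) => a b /=; lra.
have K12 : 0 < 1 + `|K1| + `|K2|.
  by have := normr_ge0 K1; have := normr_ge0 K2; lra.
exists d, D, (1 + `|K1| + `|K2|); split => //.
move=> v v0; have v1 : 1 <= (1 + v) ^+ D by rewrite exprn_ege1// lerDl ltW.
have e0 : 0 <= expR (d * ln v) by exact: expR_ge0.
have [lv|lv] := leP 0 (ln v).
  apply: (le_trans (bK1 _ lv)).
  have -> : expR ((d + D%:R) * ln v) = expR (d * ln v) * v ^+ D.
    by rewrite mulrDl expRD expRM_natl lnK ?posrE.
  apply: (@le_trans _ _ (`|K1| * (expR (d * ln v) * v ^+ D))).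
    by rewrite ler_wpM2r ?ler_norm// mulr_ge0// exprn_ge0// ltW.
  apply: ler_pM => //; first by rewrite mulr_ge0// exprn_ge0// ltW.
    by rewrite addrC addrA lerDr addr_ge0.
  by rewrite ler_wpM2l// lerXn2r ?nnegrE ?addr_ge0 ?lerDr// ltW.
have lv0 : 0 <= - ln v by rewrite oppr_ge0 ltW.
have := bK2 _ lv0; rewrite scalerN rmorphN scaleNr opprK mulrNN => h.
apply: (le_trans h); apply: (@le_trans _ _ (`|K2| * expR (d * ln v))).
  by rewrite ler_wpM2r ?ler_norm.
rewrite ler_pM// ?lerDr ?addr_ge0//.
by rewrite ler_peMr.
Qed.

End PositiveStable.

(** * Quotients of Pochhammer symbols *)

(* Syntactic matching keeps the unifier from unfolding [mx_pow]. *)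
Ltac commute_step := match goal with
  | |- GRing.comm ?x ?x => exact: commr_refl
  | H : GRing.comm ?x ?y |- GRing.comm ?x ?y => exact: H
  | H : GRing.comm ?x ?y |- GRing.comm ?y ?x => exact: (commr_sym H)
  | |- GRing.comm _ 1 => exact: commr1
  | |- GRing.comm _ (_%:R) => exact: commr_nat
  | |- GRing.comm _ (_ + _) => apply: commrD
  | |- GRing.comm _ (- _) => apply: commrN
  | |- GRing.comm _ (_ * _) => apply: commrM
  | |- GRing.comm _ (_^-1) => apply: commrV
  | |- GRing.comm _ (mx_pow _ _) => apply: comm_mx_pow
  | |- GRing.comm _ (_ *: _) => apply: commr_scale
  | |- GRing.comm (_ + _) _ => apply: commr_sym
  | |- GRing.comm (- _) _ => apply: commr_sym
  | |- GRing.comm (_ * _) _ => apply: commr_sym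
  | |- GRing.comm (_^-1) _ => apply: commr_sym
  | |- GRing.comm (mx_pow _ _) _ => apply: commr_sym
  | |- GRing.comm (_ *: _) _ => apply: commr_sym
  end.

Ltac commute := solve [repeat commute_step].

Lemma mulrACA_comm (T : pzRingType) (x y z w : T) : GRing.comm y z ->
  x * z * (y * w) = x * y * (z * w).
Proof. by move=> c; rewrite !mulrA -(mulrA x z) -c !mulrA. Qed.

Lemma expand_product_sub1 (T : pzRingType) (x t r : T) :
  (1 + x) * (1 - t + r) - 1 = x - t - x * t + (1 + x) * r.
Proof.
rewrite mulrDr addrAC; congr (_ + _).
by rewrite mulrBr mulr1 mulrDl mul1r addrAC [1 + x]addrC addrK opprD addrA.
Qed.

Section PochhammerRatio.
Variables (R : realType) (n : nat).
Local Notation mat := 'M[R[i]]_n.+1.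
Implicit Types (M N P Q S Y : mat) (u v t y tau : R).

Lemma pochhammer0 M : pochhammer M 0 = 1.
Proof. by rewrite /pochhammer big_ord0. Qed.

Lemma pochhammerS M l : pochhammer M l.+1 = pochhammer M l * (M + l%:R).
Proof. by rewrite /pochhammer big_ord_recr. Qed.

Lemma comm_pochhammer M N l : GRing.comm M N -> GRing.comm M (pochhammer N l).
Proof.
by move=> h; rewrite /pochhammer; apply: commr_prod => i _; commute.
Qed.

Lemma unit_pochhammer M l : positive_stable M -> pochhammer M l \is a
  GRing.unit.
Proof.
move=> hM; elim: l => [|l IH]; first by rewrite pochhammer0 unitr1.
rewrite pochhammerS unitrMr//.
exact/positive_stable_unit/positive_stableDn.
Qed.

Definition poch_ratio P Q j : mat := (pochhammer P j.+1)^-1 * pochhammer (P +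
  Q) j.

Lemma comm_poch_ratio M P Q j : GRing.comm M P -> GRing.comm M Q ->
  GRing.comm M (poch_ratio P Q j).
Proof.
move=> hP hQ; apply: commrM; first by apply: commrV; exact: comm_pochhammer.
by apply: comm_pochhammer; exact: commrD.
Qed.

(** The quotient [(P + Q + j) / (P + j + 1)] is written as a perturbation of 1; its leading part
    [(Q - 1) / j] is responsible for the growth [j^(Q - 1)]. *)
Lemma poch_ratioS P Q j : GRing.comm P Q -> positive_stable P ->
  poch_ratio P Q j.+1 = poch_ratio P Q j * (1 + (Q - 1) * (P + j.+1%:R)^-1).
Proof.
move=> PQ hP; have Pu k : P + k%:R \is a GRing.unit.
  exact/positive_stable_unit/positive_stableDn.
have -> : 1 + (Q - 1) * (P + j.+1%:R)^-1 = (P + Q + j%:R) * (P + j.+1%:R)^-1.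
  rewrite -{1}(mulrV (Pu j.+1)) -mulrDl; congr (_ * _).
  by rewrite -natr1 addrACA addrK.
rewrite /poch_ratio [pochhammer P j.+2]pochhammerS (pochhammerS (P + Q) j).
rewrite (invrM (unit_pochhammer _ hP) (Pu _)).
set A := (P + j.+1%:R)^-1; rewrite -!mulrA.
have cA X : GRing.comm P X -> GRing.comm A X.
  by move=> h; apply: commr_sym; apply: commrV; commute.
rewrite [LHS]cA ?mulrA//; rewrite -/(poch_ratio P Q j).
by apply: commrM; [exact: comm_poch_ratio|commute].
Qed.

(** The inverse [Y] satisfies [(j + 1) Y = 1 - P Y], and the last product is absorbed on the left as
    soon as [j + 1] exceeds twice the norm of [P]. The finitely many smaller indices are added to
    the constant. *)
Lemma l1norm_resolvent P : positive_stable P ->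
  exists2 C, 0 <= C & forall j, l1norm (P + j.+1%:R)^-1 <= C / j.+1%:R.
Proof.
move=> hP; pose f j := j.+1%:R * l1norm (P + j.+1%:R)^-1.
pose m := Num.bound (2 * l1norm P).
exists (2 * l1norm (1 : mat) + \sum_(j < m) f j).
  rewrite addr_ge0// ?mulr_ge0 ?l1norm_ge0//.
  by apply: sumr_ge0 => j _; rewrite mulr_ge0// l1norm_ge0.
move=> j; rewrite ler_pdivlMr// mulrC -/(f j).
have [jm|mj] := ltnP j m.
  rewrite (bigD1 (Ordinal jm))//= addrCA lerDl addr_ge0 ?mulr_ge0 ?l1norm_ge0//.
  by apply: sumr_ge0 => k _; rewrite mulr_ge0// l1norm_ge0.
rewrite ler_wpDr//; first by apply: sumr_ge0 => k _;
  rewrite mulr_ge0// l1norm_ge0.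
set Y := (P + j.+1%:R)^-1; rewrite /f -/Y.
have Yu : P + j.+1%:R \is a GRing.unit.
  exact/positive_stable_unit/positive_stableDn.
have YE : (j.+1%:R : R)%:C%C *: Y = 1 - P * Y.
  by rewrite -(mulrV Yu) -/Y mulrDl addrC addKr rmorph_nat scaler_nat mulr_natl.
have h1 : j.+1%:R * l1norm Y <= l1norm (1 : mat) + l1norm P * l1norm Y.
  have -> : j.+1%:R * l1norm Y = l1norm (1 - P * Y).
    by rewrite -YE l1normZ normr_nat.
  by rewrite (le_trans (l1normB _ _))// lerD2l l1normM.
have h2 : l1norm P <= j.+1%:R / 2.
  rewrite ler_pdivlMr// mulrC; apply: (@le_trans _ _ m%:R).
    by rewrite ltW// archi_boundP// mulr_ge0// l1norm_ge0.
  by rewrite ler_nat (leq_trans mj).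
have := ler_wpM2r (l1norm_ge0 Y) h2; lra.
Qed.

Lemma sum_exp_le (x : R) m : 0 <= x -> \sum_(0 <= l < m) x ^+ l / l`!%:R <=
  expR x.
Proof.
move=> x0; rewrite /expR; apply: (@nondecreasing_cvgn_le _ (series (exp_coeff
  x))).
  apply/nondecreasing_seqP => l; rewrite seriesSr /= lerDl /exp_coeff /=.
  by rewrite divr_ge0// exprn_ge0.
exact: is_cvg_series_exp_coeff.
Qed.

Lemma mx_exp_taylor2 M :
  l1norm (mx_exp M - 1 - M) <= l1norm (1 : mat) * l1norm M ^+ 2 * expR (l1norm
    M).
Proof.
have h : series (exp_coef M) (l + 2)%N - 1 - M @[l --> \oo] --> mx_exp M - 1 -
  M.
  apply: cvgB_mx; last exact: cvg_cst.
  apply: cvgB_mx; last exact: cvg_cst.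
  by have := @mx_exp_cvg _ _ M; rewrite -(cvg_shiftn 2).
apply: (l1norm_lim_le h); near=> m.
rewrite /series /= addn2 big_nat_recl// big_nat_recl//.
have -> : exp_coef M 0 = 1 by rewrite /exp_coef fact0 invr1 scale1r expr0.
have -> : exp_coef M 1 = M by rewrite /exp_coef (_ : 1`! = 1%N) // invr1
  scale1r expr1.
rewrite [1 + _]addrC addrK [M + _]addrC addrK.
rewrite (le_trans (l1norm_sum _ _ _))//.
apply: (@le_trans _ _ (\sum_(0 <= l < m) l1norm (1 : mat) * l1norm M ^+ 2 *
    (l1norm M ^+ l / l`!%:R))).
  apply: ler_sum => l _; rewrite exp_coefE l1normZ ger0_norm ?invr_ge0//.
  have f1 : (l.+2`!%:R : R)^-1 <= (l`!%:R)^-1.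
    rewrite lef_pV2 ?posrE ?ltr0n ?fact_gt0// ler_nat.
    by rewrite !factS mulnA leq_pmull.
  have -> : l1norm (1 : mat) * l1norm M ^+ 2 * (l1norm M ^+ l / l`!%:R) =
      (l`!%:R)^-1 * (l1norm (1 : mat) * l1norm M ^+ l.+2) by rewrite !exprS;
        ring.
  by apply: ler_pM => //; rewrite ?invr_ge0 ?l1norm_ge0 ?l1normX.
rewrite -mulr_sumr ler_wpM2l ?sum_exp_le ?l1norm_ge0//.
by rewrite mulr_ge0 ?exprn_ge0 ?l1norm_ge0.
Unshelve. all: by end_near. Qed.

(** The inequality [1 + y <= expR y] at [tau] and at [- tau] gives [1 / (a + 1) <= tau <= 1 / a], an
    interval of length [1 / (a (a + 1))]. *)
Lemma ln_ratio_bounds (a : R) : 0 < a -> let tau := ln ((a + 1) / a) in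
  0 <= tau <= a^-1 /\ `|(a + 1)^-1 - tau| <= (a ^+ 2)^-1.
Proof.
move=> a0 tau; have a1 : 0 < a + 1 by rewrite addr_gt0.
have [an a1n] : a != 0 /\ a + 1 != 0 by rewrite !gt_eqF.
have eT : expR tau = (a + 1) / a by rewrite lnK ?posrE ?divr_gt0.
have t1 : tau <= a^-1.
  have -> : a^-1 = (a + 1) / a - 1 by field.
  by rewrite lerBrDl -eT expR_ge1Dx.
have t2 : (a + 1)^-1 <= tau.
  have -> : (a + 1)^-1 = 1 - ((a + 1) / a)^-1 by field; rewrite an a1n.
  by rewrite lerBlDl -lerBlDr -eT -expRN expR_ge1Dx.
have t0 : 0 < (a + 1)^-1 by rewrite invr_gt0.
split; first by rewrite t1 andbT; lra.
rewrite distrC ger0_norm; last by lra.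
apply: (@le_trans _ _ (a^-1 - (a + 1)^-1)); first by lra.
have -> : a^-1 - (a + 1)^-1 = a^-1 * (a + 1)^-1 by field; rewrite an a1n.
by rewrite expr2 invfM ler_wpM2l ?invr_ge0 ?(ltW a0)// lef_pV2 ?posrE// lerDl.
Qed.

(* The exponent [1 - Q] compensates the growth of [poch_ratio P Q j], which is
   that of [j.+1 ^ (Q - 1)]: consecutive quotients are [1 + O(j ^ -2)]. *)
Definition normalized_ratio P Q j : mat := poch_ratio P Q j * mx_pow j.+1%:R (1
  - Q).

Definition normalized_step P Q j : mat :=
  (1 + (Q - 1) * (P + j.+1%:R)^-1) * mx_pow (j.+2%:R / j.+1%:R) (1 - Q).

Lemma normalized_ratioS P Q j : GRing.comm P Q -> positive_stable P ->
  normalized_ratio P Q j.+1 = normalized_ratio P Q j * normalized_step P Q j.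
Proof.
move=> PQ hP; rewrite /normalized_ratio (poch_ratioS _ PQ hP) /normalized_step.
have j1 : (0 : R) < j.+1%:R by rewrite ltr0n.
have j2 : (0 : R) < j.+2%:R / j.+1%:R by rewrite divr_gt0// ltr0n.
have -> : mx_pow (j.+2%:R : R) (1 - Q) =
    mx_pow j.+1%:R (1 - Q) * mx_pow (j.+2%:R / j.+1%:R) (1 - Q).
  by rewrite -(mx_powM _ j1 j2) mulrCA mulfV ?mulr1// gt_eqF.
have QP := commr_sym PQ.
have c : GRing.comm (mx_pow (j.+1%:R : R) (1 - Q)) (1 + (Q - 1) * (P +
  j.+1%:R)^-1).
  by commute.
exact: mulrACA_comm.
Qed.

(** With [S = Q - 1], [Y] the resolvent and [r] the second-order remainder of the exponential, the
    difference is [S (Y - tau) - tau S Y S + (1 + S Y) r]. First-order terms cancel because [Y] and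
    [tau] are both [1 / j] up to [O(j^-2)]. *)
Lemma normalized_step_bound P Q : positive_stable P ->
  exists2 C, 0 <= C & forall j, l1norm (normalized_step P Q j - 1) <= C /
    j.+1%:R ^+ 2.
Proof.
move=> hP; have [K K0 bK] := l1norm_resolvent hP.
pose S := Q - 1; pose a := l1norm S; pose o := l1norm (1 : mat).
have a0 : 0 <= a := l1norm_ge0 _. have o0 : 0 <= o := l1norm_ge0 _.
exists (a * (K * l1norm (1 - P) + o) + a * K * a + (o + a * K) * (o * a ^+ 2 *
  expR a)).
  by rewrite !addr_ge0 ?mulr_ge0 ?addr_ge0 ?mulr_ge0 ?l1norm_ge0 ?expR_ge0
    ?exprn_ge0.
move=> j; rewrite /normalized_step -/S; set Y := (P + j.+1%:R)^-1.
set tau := ln (j.+2%:R / j.+1%:R) : R.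
have := @ln_ratio_bounds j.+1%:R (ltr0Sn _ _); rewrite natr1 -/tau.
move=> [/andP[t0 t1] t2].
have q0 : (0 : R) < j.+1%:R^-1 by rewrite invr_gt0.
have q1 : (j.+1%:R^-1 : R) <= 1 by rewrite invf_le1 ?ler1n.
set q := j.+1%:R^-1 in t1 q0 q1.
have qE : (j.+1%:R ^+ 2)^-1 = q ^+ 2 :> R by rewrite exprVn.
rewrite qE in t2 *.
rewrite /mx_pow -/tau; pose r := mx_exp (tau%:C%C *: (1 - Q)) - 1 - tau%:C%C *:
  (1 - Q).
have SE : 1 - Q = - S by rewrite opprB.
have nY : l1norm Y <= K * q by exact: bK.
have nr : l1norm r <= o * a ^+ 2 * expR a * q ^+ 2.
  apply: (le_trans (mx_exp_taylor2 _)); rewrite SE scalerN l1normN l1normZ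
    (ger0_norm t0).
  have ta : tau * a <= q * a by rewrite ler_wpM2r.
  have -> : o * a ^+ 2 * expR a * q ^+ 2 = o * (q * a) ^+ 2 * expR a by ring.
  apply: ler_pM; rewrite ?expR_ge0 ?mulr_ge0 ?sqr_ge0//.
    by rewrite ler_wpM2l// ler_sqr ?nnegrE ?mulr_ge0// ltW.
  by rewrite ler_expR (le_trans ta)// ler_piMl.
have -> : mx_exp (tau%:C%C *: (1 - Q)) = 1 - tau%:C%C *: S + r.
  have -> : r = mx_exp (tau%:C%C *: (1 - Q)) - (1 - tau%:C%C *: S).
    by rewrite /r SE scalerN opprK -addrA opprB [- 1 + _]addrC.
  by rewrite [RHS]addrC subrK.
have -> : (1 + S * Y) * (1 - tau%:C%C *: S + r) - 1 =
    S * (Y - tau%:C%C *: 1) - tau%:C%C *: (S * Y * S) + (1 + S * Y) * r.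
  rewrite expand_product_sub1; congr (_ - _ + _); last by rewrite -scalerAr.
  by rewrite mulrBr -scalerAr mulr1.
have nYt : l1norm (Y - tau%:C%C *: 1) <= (K * l1norm (1 - P) + o) * q ^+ 2.
  have Yu : P + j.+1%:R \is a GRing.unit.
    exact/positive_stable_unit/positive_stableDn.
  (* Resolvent identity against the scalar [j + 2], whose inverse is the quantity that
     [ln_ratio_bounds] compares with [tau]. *)
  have YE : Y - (j.+2%:R^-1 : R)%:C%C *: 1 = (j.+2%:R^-1 : R)%:C%C *: (Y * (1 -
    P)).
    have -> : 1 - P = (j.+2%:R : R)%:C%C *: 1 - (P + j.+1%:R).
      by rewrite rmorph_nat scaler_nat -[j.+2%:R]natr1 [P + _]addrC opprD addrA
        [_ + 1]addrC addrK.
    rewrite mulrBr mulVr// -scalerAr mulr1 scalerBr scalerA -rmorphM.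
    by rewrite mulVf ?pnatr_eq0// scale1r.
  rewrite -(subrK ((j.+2%:R^-1 : R)%:C%C *: 1) Y) -addrA -scalerBl -rmorphB.
  rewrite (le_trans (l1normD _ _))// YE !l1normZ mulrDl.
  have j2 : `|(j.+2%:R^-1 : R)| <= q.
    by rewrite ger0_norm ?invr_ge0// lef_pV2 ?posrE// ler_nat.
  apply: lerD; last by rewrite mulrC ler_wpM2l.
  have -> : K * l1norm (1 - P) * q ^+ 2 = q * (K * q * l1norm (1 - P)) by ring.
  apply: ler_pM; rewrite ?l1norm_ge0//.
  by rewrite (le_trans (l1normM _ _))// ler_wpM2r// l1norm_ge0.
clearbody S; rewrite (le_trans (l1normD _ _))// [leRHS]mulrDl lerD//.
  rewrite (le_trans (l1normB _ _))// [leRHS]mulrDl lerD//.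
    by rewrite -mulrA (le_trans (l1normM _ _))// ler_wpM2l.
  rewrite l1normZ (ger0_norm t0).
  have -> : a * K * a * q ^+ 2 = q * (a * (K * q) * a) by ring.
  apply: ler_pM; rewrite ?l1norm_ge0//.
  rewrite (le_trans (l1normM _ _))// ler_wpM2r// (le_trans (l1normM _ _))//.
  by rewrite ler_wpM2l.
rewrite -(mulrA (o + a * K)) (le_trans (l1normM _ _))//; apply: ler_pM;
  rewrite ?l1norm_ge0//.
rewrite (le_trans (l1normD _ _))// lerD2l (le_trans (l1normM _ _))//
  ler_wpM2l//.
by rewrite (le_trans nY)// ler_piMr.
Qed.

Lemma normalized_ratio_bound P Q : GRing.comm P Q -> positive_stable P ->
  exists2 C, 0 <= C & forall j, l1norm (normalized_ratio P Q j) <= C.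
Proof.
move=> PQ hP; have [C C0 bC] := normalized_step_bound Q hP.
pose g0 := l1norm (normalized_ratio P Q 0).
have g00 : 0 <= g0 := l1norm_ge0 _.
(* The factors are at most [expR (C / a^2)] with [a = j + 1], and
   [1 / a^2 <= 2 (1 / a - 1 / (a + 1))] for [a >= 1]; the exponent is the resulting telescoping
   sum. *)
have H j : l1norm (normalized_ratio P Q j) <= g0 * expR (2 * C * (1 -
  j.+1%:R^-1)).
  elim: j => [|j IH]; first by rewrite invr1 subrr mulr0 expR0 mulr1.
  rewrite normalized_ratioS//.
  rewrite -[normalized_step P Q j](subrK 1) mulrDr mulr1.
  apply: (@le_trans _ _ (l1norm (normalized_ratio P Q j) * expR (C / j.+1%:R ^+
    2))).
    rewrite (le_trans (l1normD _ _))// -lerBrDr -[X in _ <= _ - X]mulr1 -mulrBr.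
    rewrite (le_trans (l1normM _ _))// ler_wpM2l ?l1norm_ge0// lerBrDr addrC.
    by rewrite (le_trans _ (expR_ge1Dx _))// lerD2l.
  rewrite (le_trans (ler_wpM2r (expR_ge0 _) IH))// -(mulrA g0) -expRD
    ler_wpM2l//.
  rewrite ler_expR -[leRHS]mulrA -[X in X + _ <= _]mulrA mulrCA [leRHS]mulrCA
    -mulrDr ler_wpM2l//.
  have -> : 2 * (1 - j.+2%:R^-1) = 2 * (1 - j.+1%:R^-1) + 2 * (j.+1%:R^-1 -
    j.+2%:R^-1) :> R.
    by ring.
  rewrite lerD2l -[j.+2%:R]natr1; set a : R := j.+1%:R.
  have a1 : 1 <= a by rewrite ler1n.
  have -> : 2 * (a^-1 - (a + 1)^-1) = (a ^+ 2)^-1 * (2 * a / (a + 1)).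
    by field; rewrite !gt_eqF//; lra.
  rewrite ler_peMr ?invr_ge0 ?sqr_ge0// ler_pdivlMr ?mul1r; lra.
exists (g0 * expR (2 * C)); first by rewrite mulr_ge0 ?expR_ge0.
move=> j; rewrite (le_trans (H j))// ler_wpM2l// ler_expR ler_piMr ?mulr_ge0//.
Qed.

End PochhammerRatio.

(** * A uniform bound for a scalar kernel sum *)

Section KernelSum.
Variable R : realType.
Implicit Types (a b d u v y : R).

(** With [L = ln (a / b)] and [w = 1 - b / a <= L] one has [b^d = a^d expR (- d L)], where the
    exponential is at most [1 / (1 + d w)], and [1 - 1 / (1 + d w) >= d w / (1 + d)]. This treats
    [d < 1] and [d > 1] alike. *)
Lemma power_increment d a b : 0 < d -> 0 < b <= a ->
  d / (1 + d) * expR (d * ln a) * (1 - b / a) <= expR (d * ln a) - expR (d * ln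
    b).
Proof.
move=> d0 /andP[b0 ba]; have a0 : 0 < a := lt_le_trans b0 ba.
pose w := 1 - b / a; pose L := ln a - ln b.
have w0 : 0 <= w by rewrite subr_ge0 ler_pdivrMr ?mul1r.
have w1 : w <= 1 by rewrite gerBl divr_ge0// ltW.
have wL : w <= L.
  have -> : w = 1 - expR (- L).
    by rewrite /w /L opprB -ln_div ?posrE// lnK ?posrE ?divr_gt0.
  by rewrite lerBlDl -lerBlDr expR_ge1Dx.
have -> : expR (d * ln b) = expR (d * ln a) * expR (- (d * L)).
  by rewrite -expRD /L mulrBr opprB addrC subrK.
rewrite -[X in _ <= X - _]mulr1 -mulrBr mulrAC mulrC ler_wpM2l ?expR_ge0//.
rewrite -/w; have dw0 : 0 <= d * w by rewrite mulr_ge0// ltW.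
have e1 : expR (- (d * L)) <= (1 + d * w)^-1.
  rewrite expRN lef_pV2 ?posrE ?expR_gt0 ?ltr_pwDl//.
  by rewrite (le_trans (expR_ge1Dx _))// ler_expR ler_wpM2l// ltW.
apply: (@le_trans _ _ (1 - (1 + d * w)^-1)); last by rewrite lerD2l lerN2.
have -> : 1 - (1 + d * w)^-1 = d * w / (1 + d * w) by field;
  rewrite gt_eqF// ltr_pwDl.
rewrite mulrAC ler_wpM2l// lef_pV2 ?posrE ?ltr_pwDl ?addr_gt0//.
by rewrite lerD2l ler_piMr// ltW.
exact: ltW.
Qed.

Lemma exprS_le_exp (v : R) k : 0 <= v -> (1 + v) ^+ k <= k`!%:R * expR (1 + v).
Proof.
move=> v0; have v1 : 0 <= 1 + v by rewrite addr_ge0.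
by rewrite mulrC -ler_pdivrMr ?ltr0n ?fact_gt0// expR_geXn.
Qed.

(** Up to a constant, the bound on [u ^+ j * l1norm (mx_pow (1 - u) Q * poch_ratio P Q j)] at
    [u = 1 - y]: the growth of the ratio is moved into the argument [(j + 1) y] of the power. *)
Definition kernel_term d (D : nat) y j : R :=
  (1 - y) ^+ j / j.+1%:R * (expR (d * ln (j.+1%:R * y)) * (1 + j.+1%:R * y) ^+
    D).

(* The [j]-th term is at most a constant times the increment over
   [[j y, (j + 1) y]] of the bounded increasing function [(v / (1 + v)) ^ d]. *)
Lemma kernel_sum_bound d (D : nat) : 0 < d ->
  exists2 C, 0 <= C & forall y m, 0 < y < 1 -> \sum_(j < m) kernel_term d D y j
    <= C.
Proof.
(* Of the [K] powers of [1 + v], [D] absorb the polynomial factor, [E >= d] replace [v^d] by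
   [(v / (1 + v))^d], and one yields the factor [1 / (1 + v)] of the increment. [C1] is the product
   of [(1 - y)^j <= expR (1 - v)] and [(1 + v)^K <= K! expR (1 + v)]; [C0] also undoes the constant
   of [power_increment]. *)
move=> d0; pose E := Num.bound d; pose K := (D.+1 + E)%N.
pose C1 : R := K`!%:R * expR 2; pose C0 := C1 * ((1 + d) / d).
have C10 : 0 <= C1 by rewrite mulr_ge0 ?expR_ge0.
have d1 : 0 < 1 + d by rewrite addr_gt0.
have C00 : 0 <= C0 by rewrite mulr_ge0// divr_ge0 ?(ltW d0) ?(ltW d1)//.
exists C0 => // y m /andP[y0 y1].
pose th v := expR (d * ln (v / (1 + v))).
(* The weight [w] is left free: the term [j = 0] takes [w = 1], the later ones the relative
   increment [1 - b / a]. *)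
have key j w : w <= 1 -> (j.+1%:R * (1 + j.+1%:R * y))^-1 <= w ->
    kernel_term d D y j <= C0 * (d / (1 + d) * th (j.+1%:R * y) * w).
  move=> w1 hw; set v := j.+1%:R * y in hw *.
  have v0 : 0 < v by rewrite mulr_gt0.
  have v1 : 0 < 1 + v by rewrite addr_gt0.
  have thE : th v = expR (d * ln v) * expR (- (d * ln (1 + v))).
    by rewrite /th ln_div ?posrE// mulrBr expRD.
  have uj : (1 - y) ^+ j <= expR (1 - v).
    apply: (@le_trans _ _ (expR (- (j%:R * y)))).
      rewrite -mulrN expRM_natl lerXn2r ?nnegrE ?expR_ge0 ?subr_ge0 ?(ltW y1)//.
      exact: expR_ge1Dx.
    by rewrite ler_expR /v -natr1 mulrDl mul1r; lra.
  have kb : (1 - y) ^+ j * (1 + v) ^+ K <= C1.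
    apply: (@le_trans _ _ (expR (1 - v) * (K`!%:R * expR (1 + v)))).
      apply: ler_pM => //; rewrite ?exprn_ge0 ?subr_ge0 ?(ltW y1) ?(ltW v1)//.
      by rewrite exprS_le_exp// ltW.
    rewrite mulrCA -expRD /C1 ler_wpM2l// ler_expR; lra.
  have Ed : expR (d * ln (1 + v)) <= (1 + v) ^+ E.
    rewrite -{2}(@lnK _ (1 + v)) ?posrE// -expRM_natl ler_expR ler_wpM2r//.
      by rewrite ln_ge0// lerDl ltW.
    by rewrite ltW// archi_boundP// ltW.
  have kb2 : (1 - y) ^+ j * (1 + v) ^+ D <= C1 * expR (- (d * ln (1 + v))) / (1
    + v).
    rewrite ler_pdivlMr// expRN ler_pdivlMr ?expR_gt0//.
    apply: le_trans kb; rewrite /K exprD exprSr -!mulrA !ler_wpM2l ?exprn_ge0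
      ?subr_ge0 ?(ltW y1) ?(ltW v1)//.
  have j0 : (0 : R) < j.+1%:R by [].
  apply: (@le_trans _ _ (C0 * (d / (1 + d) * th v * (j.+1%:R * (1 + v))^-1)));
    last first.
    rewrite ler_wpM2l// ler_wpM2l// mulr_ge0 ?expR_ge0// divr_ge0 ?(ltW d0)
      ?(ltW d1)//.
  rewrite /kernel_term -/v.
  have -> : C0 * (d / (1 + d) * th v * (j.+1%:R * (1 + v))^-1) =
      expR (d * ln v) / j.+1%:R * (C1 * expR (- (d * ln (1 + v))) / (1 + v)).
    rewrite thE /C0; field.
    by rewrite !gt_eqF.
  have -> : (1 - y) ^+ j / j.+1%:R * (expR (d * ln v) * (1 + v) ^+ D) =
      expR (d * ln v) / j.+1%:R * ((1 - y) ^+ j * (1 + v) ^+ D) by ring.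
  by rewrite ler_wpM2l// divr_ge0 ?expR_ge0.
have th1 v : 0 < v -> th v <= 1.
  move=> v0; rewrite /th -expR0 ler_expR pmulr_rle0// ln_le0//.
  by rewrite ler_pdivrMr ?addr_gt0// mul1r lerDr.
have H k : \sum_(j < k.+1) kernel_term d D y j <= C0 * th (k.+1%:R * y).
  elim: k => [|k IH].
    rewrite big_ord1 (le_trans (key 0%N 1 _ _))//.
      by rewrite !mul1r invf_le1 ?addr_gt0// lerDl ltW.
    rewrite mulr1 ler_wpM2l// ler_piMl ?expR_ge0// ler_pdivrMr// mul1r.
    by rewrite lerDr.
  rewrite big_ord_recr /=; set v := k.+2%:R * y.
  pose b := k.+1%:R * y / (1 + k.+1%:R * y); pose a := v / (1 + v).
  have k0 : 0 < k.+1%:R * y by rewrite mulr_gt0.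
  have v0 : 0 < v by rewrite mulr_gt0.
  have vE : v = k.+1%:R * y + y by rewrite /v -natr1 mulrDl mul1r.
  have b0 : 0 < b by rewrite divr_gt0// addr_gt0.
  have a0 : 0 < a by rewrite divr_gt0// addr_gt0.
  have ba : 0 < b <= a.
    rewrite b0 /= /a /b ler_pdivrMr ?addr_gt0// mulrAC ler_pdivlMr ?addr_gt0//.
    rewrite vE; lra.
  have wE : 1 - b / a = y / (v * (1 + k.+1%:R * y)).
    rewrite /a /b vE; field; rewrite !gt_eqF//; lra.
  have := power_increment d0 ba; rewrite -/(th v) -/(th (k.+1%:R * y)) => inc.
  have := key k.+1 (1 - b / a); rewrite -/v => /(_ _ _) h.
  apply: (le_trans (lerD IH (h _ _))).
  - by rewrite gerBl divr_ge0 ?(ltW b0) ?(ltW a0).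
  - rewrite wE.
    have -> : y / (v * (1 + k.+1%:R * y)) = (k.+2%:R * (1 + k.+1%:R * y))^-1.
      rewrite /v; move: (1 + k.+1%:R * y) (k.+2%:R) => e c.
      by rewrite mulrAC invfM mulrCA mulfV ?mulr1// gt_eqF.
    rewrite lef_pV2 ?posrE ?mulr_gt0 ?addr_gt0// ler_wpM2l// lerD2l vE; lra.
  - by rewrite -mulrDr ler_wpM2l//; lra.
case: m => [|m]; first by rewrite big_ord0.
by rewrite (le_trans (H m))// -[leRHS]mulr1 ler_wpM2l// th1// mulr_gt0.
Qed.

End KernelSum.

Lemma mulr_cancel_mid (T : pzRingType) (x a b y : T) : a * b = 1 ->
  x * a * (b * y) = x * y.
Proof. by move=> ab; rewrite mulrA -(mulrA x) ab mulr1. Qed.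

Section MatrixKernelSum.
Variables (R : realType) (n : nat).
Local Notation mat := 'M[R[i]]_n.+1.
Implicit Types (M N P Q : mat) (u v y : R).

(** With [a = j + 1], write [y^Q = a^(-Q) (a y)^Q]; then [a^(-Q)] times the ratio is the bounded
    normalized ratio divided by [a]. *)
Lemma mx_pow_ratio_bound P Q : GRing.comm P Q -> positive_stable P ->
  exists2 C, 0 <= C & forall j y, 0 < y ->
    l1norm (mx_pow y Q * poch_ratio P Q j) <=
    C / j.+1%:R * l1norm (mx_pow (j.+1%:R * y) Q).
Proof.
move=> PQ hP; have [C C0 bC] := normalized_ratio_bound PQ hP.
exists C => // j y y0; set a : R := j.+1%:R; have a0 : 0 < a by [].
have -> : mx_pow y Q * poch_ratio P Q j =
    (a^-1)%:C%C *: (normalized_ratio P Q j * mx_pow (a * y) Q).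
  have E1 : mx_pow a Q = a%:C%C *: mx_pow a (Q - 1).
    by rewrite -(mx_powS _ a0) subrK.
  have E2 : mx_pow a (1 - Q) * mx_pow a (Q - 1) = 1.
    by rewrite -[X in _ * mx_pow a X]opprK opprB mx_powNK.
  rewrite /normalized_ratio -/a (mx_powM _ a0 y0) E1 -scalerAl -scalerAr
    scalerA.
  have -> : (a^-1)%:C%C * a%:C%C = 1.
    by rewrite -rmorphM (mulVf (lt0r_neq0 a0)).
  rewrite scale1r (mulr_cancel_mid _ _ E2).
  have QP : GRing.comm Q P by exact: commr_sym.
  by apply: comm_poch_ratio; apply: commr_sym; apply: comm_mx_pow; commute.
rewrite l1normZ ger0_norm ?invr_ge0 ?(ltW a0)// [C / a]mulrC -(mulrA _ C).
rewrite ler_wpM2l ?invr_ge0 ?(ltW a0)//.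
by rewrite (le_trans (l1normM _ _))// ler_wpM2r ?l1norm_ge0.
Qed.

(** Norms are taken term by term, so the bound survives when each term is multiplied by a bounded
    tail; uniformity in [u] is what Abel's argument at 1 requires. *)
Lemma mx_kernel_sum_bound P Q : GRing.comm P Q -> positive_stable P ->
  positive_stable Q ->
  exists2 C, 0 <= C & forall u m, 0 < u < 1 ->
    \sum_(j < m) u ^+ j * l1norm (mx_pow (1 - u) Q * poch_ratio P Q j) <= C.
Proof.
move=> PQ hP hQ; have [C C0 bC] := mx_pow_ratio_bound PQ hP.
have [d [D [K [d0 K0 bK]]]] := mx_pow_bound hQ.
have [B B0 bB] := kernel_sum_bound D d0.
exists (C * K * B); first by rewrite !mulr_ge0// ltW.
move=> u m /andP[u0 u1].
have y1 : 0 < 1 - u < 1 by rewrite subr_gt0 u1 gtrBl.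
have y0 : 0 < 1 - u by rewrite subr_gt0.
apply: le_trans (ler_wpM2l (mulr_ge0 C0 (ltW K0)) (bB _ m y1)).
rewrite mulr_sumr; apply: ler_sum => j _; rewrite /kernel_term subKr.
have j0 : (0 : R) < j.+1%:R by [].
apply: (@le_trans _ _ (u ^+ j * (C / j.+1%:R * (K * (expR (d * ln (j.+1%:R * (1
  - u))) *
     (1 + j.+1%:R * (1 - u)) ^+ D))))).
  rewrite ler_wpM2l ?exprn_ge0 ?(ltW u0)// (le_trans (bC _ _ y0))//.
  by rewrite ler_wpM2l ?divr_ge0// bK// mulr_gt0.
by rewrite le_eqVlt; apply/orP; left; apply/eqP; ring.
Qed.

End MatrixKernelSum.

(** * Improper integrals and the beta density *)

Section FundamentalTheorem.
Variables (R : realType) (n : nat).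
Local Notation mat := 'M[R[i]]_n.+1.
Local Notation mu := (@lebesgue_measure R).
Implicit Types (f F : R -> mat).

Lemma derive_continuous (g : R -> R) (dg x : R) : is_derive x (1 : R) g dg ->
  {for x, continuous g}.
Proof.
by move=> [dgx _]; apply: differentiable_continuous; exact/derivable1_diffP.
Qed.

Lemma segment_FTC (g G : R -> R) (a b c d : R) :
  (forall u, a < u < b -> is_derive u (1 : R) G (g u)) ->
  (forall u, a < u < b -> {for u, continuous g}) ->
  a < c -> c < d -> d < b ->
  mu.-integrable `[c, d] (EFin \o g) /\
  (\int[mu]_(u in `[c, d]) g u)%R = G d - G c.
Proof.
move=> dG cg ac cd db.
have cgw : {within `[c, d], continuous g}.
  apply: continuous_in_subspaceT => x; rewrite inE /= in_itv /= => /andP[cx xd].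
  by apply: cg; rewrite (lt_le_trans ac cx) (le_lt_trans xd db).
split; first by apply: continuous_compact_integrable => //;
  exact: segment_compact.
rewrite /Rintegral (@continuous_FTC2 _ g G)//.
- split.
  + move=> x; rewrite in_itv /= => /andP[cx xd].
    have [|//] := dG x; by rewrite (lt_trans ac cx) (lt_trans xd db).
  + apply: cvg_at_right_filter; apply: derive_continuous (dG c _).
    by rewrite ac (lt_trans cd db).
  + apply: cvg_at_left_filter; apply: derive_continuous (dG d _).
    by rewrite db (lt_trans ac cd).
- move=> x; rewrite in_itv /= => /andP[cx xd].
  rewrite derive1E; have [|_ //] := dG x.
  by rewrite (lt_trans ac cx) (lt_trans xd db).
Qed.

Lemma improper_integral_primitive f F (a b : R) (L0 L1 : mat) : a < b ->
  (forall u, a < u < b -> mx_derive F u (f u)) ->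
  (forall u, a < u < b -> f s @[s --> u] --> f u) ->
  F s @[s --> a^'+] --> L0 -> F s @[s --> b^'-] --> L1 ->
  is_improper_integral f a^'+ b^'- (L1 - L0).
Proof.
move=> ab dF cf FL0 FL1; pose m := (a + b) / 2.
have am : a < m by rewrite /m; lra.
have mb : m < b by rewrite /m; lra.
(* The two ends move independently; separating them by the midpoint guarantees [c < d]. *)
have N : \forall cd \near filter_prod a^'+ b^'-,
    a < cd.1 /\ cd.1 < cd.2 /\ cd.2 < b.
  exists ([set c | a < c < m], [set d | m < d < b]) => /=.
    split; first by near=> c; apply/andP; split; near: c;
      [exact: nbhs_right_gt|exact: nbhs_right_lt].
    by near=> c; apply/andP; split; near: c;
      [exact: nbhs_left_gt|exact: nbhs_left_lt].
  move=> [c d] [/= /andP[ac cm] /andP[md db]]; split => //; split => //.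
  exact: lt_trans cm md.
have K c d p : a < c -> c < d -> d < b ->
    mu.-integrable `[c, d] (EFin \o (fun u => mxpart p (f u))) /\
    (\int[mu]_(u in `[c, d]) mxpart p (f u))%R = mxpart p (F d) - mxpart p (F
      c).
  move=> ac cd db; apply: (@segment_FTC _ (fun u => mxpart p (F u)) a b) => //.
    by move=> u uab; exact: dF.
  by move=> u uab; have /cvg_mxpartP := cf u uab; exact.
split.
  apply: filterS N => -[c d] /= [ac [cd db]] i j; split.
    by have [+ _] := K c d (i, j, true) ac cd db.
  by have [+ _] := K c d (i, j, false) ac cd db.
have : F cd.2 - F cd.1 @[cd --> filter_prod a^'+ b^'-] --> L1 - L0.
  apply: cvgB_mx; first by apply: cvg_comp FL1; exact: cvg_snd.
  by apply: cvg_comp FL0; exact: cvg_fst.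
apply: cvg_trans; apply: near_eq_cvg; apply: filterS N => -[c d] /= [ac [cd
  db]].
apply: mxpart_inj => -[[i j] []]; rewrite mxpartB /mx_integral [RHS]/mxpart
  /cpart /= mxE /=.
  by have [_ <-] := K c d (i, j, true) ac cd db.
by have [_ <-] := K c d (i, j, false) ac cd db.
Unshelve. all: by end_near. Qed.

Lemma continuous_primitive (f : R -> mat) (a b : R) :
  (forall u, f s @[s --> u] --> f u) ->
  exists F, forall u, a < u < b -> mx_derive F u (f u).
Proof.
move=> cf; pose I p (x : R) := (\int[mu]_(t in `[a, x]) mxpart p (f t))%R.
exists (fun x => \matrix_(i, j) Complex (I (i, j, true) x) (I (i, j, false) x)).
move=> u /andP[au ub] p.
have -> : (fun s => mxpart p
   (\matrix_(i, j) Complex (I (i, j, true) s) (I (i, j, false) s))) = I p.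
  by apply/funext => s; case: p => -[i j] []; rewrite /mxpart /cpart /= mxE.
have cp : continuous (fun t => mxpart p (f t)).
  by move=> x; have /cvg_mxpartP := cf x; exact.
have fi : (@lebesgue_measure R).-integrable `[a, b]
    (EFin \o (fun t => mxpart p (f t))).
  apply: continuous_compact_integrable; first exact: segment_compact.
  exact: continuous_subspaceT.
have [dI EI] := continuous_FTC1_closed ub fi au (cp u).
by apply: DeriveDef; [exact: dI|rewrite -derive1E; exact: EI].
Qed.

End FundamentalTheorem.

Section BetaKernel.
Variables (R : realType) (n : nat).
Local Notation mat := 'M[R[i]]_n.+1.
Implicit Types (M P Q : mat) (u v e : R).

Lemma mx_pow_bounded01 M : positive_stable M ->
  exists2 K, 0 < K & forall u, 0 < u <= 1 -> l1norm (mx_pow u M) <= K.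
Proof.
move=> hM; have [d [D [K [d0 K0 bK]]]] := mx_pow_bound hM.
exists (K * 2 ^+ D); first by rewrite mulr_gt0// exprn_gt0.
move=> u /andP[u0 u1]; rewrite (le_trans (bK _ u0))// ler_wpM2l ?(ltW K0)//.
rewrite -[leRHS]mul1r; apply: ler_pM; rewrite ?expR_ge0 ?exprn_ge0 ?addr_ge0
  ?(ltW u0)//.
  by rewrite -expR0 ler_expR pmulr_rle0// ln_le0.
by rewrite lerXn2r ?nnegrE ?addr_ge0 ?(ltW u0)//; lra.
Qed.

Lemma mx_pow_small M e : positive_stable M -> 0 < e ->
  exists2 eta, 0 < eta & forall u, 0 < u < eta -> l1norm (mx_pow u M) <= e.
Proof.
move=> hM e0; have [d [D [K [d0 K0 bK]]]] := mx_pow_bound hM.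
have K2 : 0 < K * 2 ^+ D by rewrite mulr_gt0// exprn_gt0.
pose q := e / (K * 2 ^+ D); have q0 : 0 < q by rewrite divr_gt0.
(* [expR (ln q / d)] is the [d]-th root of [q]; the minimum with 1 keeps [1 + u] below 2. *)
exists (Num.min 1 (expR (ln q / d))); first by rewrite lt_min ltr01 expR_gt0.
move=> u /andP[u0]; rewrite lt_min => /andP[u1 uq].
rewrite (le_trans (bK _ u0))//.
have -> : e = K * (q * 2 ^+ D) by rewrite /q; field;
  rewrite !gt_eqF// exprn_gt0.
rewrite ler_wpM2l ?(ltW K0)//.
apply: ler_pM; rewrite ?expR_ge0 ?exprn_ge0 ?addr_ge0 ?(ltW u0)//.
  rewrite -[leRHS]lnK ?posrE// ler_expR -ler_pdivlMl// mulrC.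
  by rewrite -ler_expR lnK ?posrE// ltW.
by rewrite lerXn2r ?nnegrE ?addr_ge0 ?(ltW u0)//; lra.
Qed.

Definition beta_kernel P Q u : mat := mx_pow u P * mx_pow (1 - u) Q.

Definition beta_density P Q u : mat := mx_pow u (P - 1) * mx_pow (1 - u) (Q -
  1).

Lemma beta_kernelE P Q u : 0 < u < 1 ->
  beta_kernel P Q u = (u * (1 - u))%:C%C *: beta_density P Q u.
Proof.
move=> /andP[u0 u1]; have v0 : 0 < 1 - u by rewrite subr_gt0.
rewrite /beta_kernel /beta_density (mx_powB1 _ u0) (mx_powB1 _ v0).
rewrite -scalerAl -scalerAr !scalerA -!rmorphM.
have -> : u * (1 - u) / u / (1 - u) = 1 by field; rewrite !gt_eqF.
by rewrite scale1r.
Qed.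

Lemma mx_pow_subr_derive M v u : u < v ->
  mx_derive (fun s => mx_pow (v - s) M) u
    (- ((v - u)^-1)%:C%C *: (M * mx_pow (v - u) M)).
Proof.
move=> uv; have v0 : 0 < v - u by rewrite subr_gt0.
have d1 : is_derive u (1 : R) (fun s => v - s) (- 1).
  by rewrite -[- 1]add0r; exact: is_deriveB.
apply: mx_derive_eq (mx_derive_comp d1 (mx_pow_derive M v0)) _.
by rewrite scalerA rmorphN mulN1r.
Qed.

Lemma beta_kernel_derive P Q u : GRing.comm P Q -> 0 < u < 1 ->
  mx_derive (beta_kernel P Q) u
    (((1 - u)%:C%C *: P - u%:C%C *: Q) * beta_density P Q u).
Proof.
move=> PQ u01; have /andP[u0 u1] := u01; have v0 : 0 < 1 - u by rewrite
  subr_gt0.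
have QP := commr_sym PQ.
apply: mx_derive_eq (mx_deriveM (mx_pow_derive P u0) (mx_pow_subr_derive Q u1))
  _.
have c : GRing.comm (mx_pow u P) Q by commute.
rewrite -scalerAl -scalerAr -mulrA (mulrA (mx_pow u P)) c -(mulrA Q).
rewrite -/(beta_kernel P Q u) (beta_kernelE _ _ u01) mulrBl -!scalerAl
  -!scalerAr.
rewrite -rmorphN; apply: mxpart_inj => p; rewrite !(mxpartD, mxpartN, mxpartZ).
by field; rewrite !gt_eqF.
Qed.

Lemma beta_kernel_small P Q e : positive_stable P -> positive_stable Q -> 0 < e
  ->
  exists2 eta, 0 < eta & forall u, 0 < u < 1 -> (u < eta) || (1 - eta < u) ->
    l1norm (beta_kernel P Q u) <= e.
Proof.
move=> hP hQ e0; have [K K0 bK] := mx_pow_bounded01 hP.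
have [K' K'0 bK'] := mx_pow_bounded01 hQ.
have [eta eta0 s1] := mx_pow_small hP (divr_gt0 e0 K'0).
have [eta' eta'0 s2] := mx_pow_small hQ (divr_gt0 e0 K0).
exists (Num.min eta eta'); first by rewrite lt_min eta0.
move=> u /andP[u0 u1] H; have v0 : 0 < 1 - u by rewrite subr_gt0.
have v1 : 1 - u <= 1 by rewrite gerBl ltW.
rewrite (le_trans (l1normM _ _))//; move/orP: H => [].
  rewrite lt_min => /andP[h _].
  rewrite -[leRHS](@divfK _ K') ?gt_eqF// ler_pM ?l1norm_ge0//;
    last by rewrite bK'// v0.
  by rewrite s1// u0.
move=> h; have h' : 1 - u < eta'.
  have : Num.min eta eta' <= eta' by rewrite ge_min lexx orbT.
  lra.
rewrite -[leRHS](@divfK _ K) ?gt_eqF// mulrC ler_pM ?l1norm_ge0//.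
  by rewrite s2// v0.
by rewrite bK// u0 ltW.
Qed.

Lemma cvg_mx0P (f : R -> mat) (F : set_system R) {FF : Filter F} :
  (forall e, 0 < e -> \forall s \near F, l1norm (f s) <= e) -> f s @[s --> F]
    --> (0 : mat).
Proof.
move=> H; apply/cvg_l1normP; apply/cvgr0Pnorm_le => e e0.
by apply: filterS (H e e0) => s; rewrite subr0 ger0_norm ?l1norm_ge0.
Qed.

(** Extended by 0, the kernel is continuous on the whole line, so it has a primitive that is
    continuous at 0 and at 1. *)
Lemma beta_kernel_ext_continuous P Q : GRing.comm P Q ->
  positive_stable P -> positive_stable Q ->
  let f u := if 0 < u < 1 then beta_kernel P Q u else 0 in
  forall u, f s @[s --> u] --> f u.
Proof.
move=> PQ hP hQ f u; have [u01|] := boolP (0 < u < 1).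
  apply: mx_derive_continuous.
  apply: near_mx_derive (beta_kernel_derive PQ u01).
  have /andP[u0 u1] := u01.
  near=> s; rewrite /f ifT//; apply/andP; split; near: s.
    exact: lt_nbhsr.
  exact: lt_nbhsl.
rewrite negb_and -!leNgt => u01.
have -> : f u = 0.
  by rewrite /f ifF//; apply/negbTE; rewrite negb_and -!leNgt.
apply: cvg_mx0P => // e e0.
have [eta eta0 H] := beta_kernel_small hP hQ e0.
move/orP: u01 => [u0|u1].
  near=> s; rewrite /f; case: ifPn => [s01|_]; last by rewrite l1norm0 ltW.
  apply: H => //; apply/orP; left; near: s.
  by apply: lt_nbhsl; apply: le_lt_trans eta0.
near=> s; rewrite /f; case: ifPn => [s01|_]; last by rewrite l1norm0 ltW.
apply: H => //; apply/orP; right; near: s.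
by apply: lt_nbhsr; rewrite ltrBlDr (le_lt_trans u1)// ltrDl.
Unshelve. all: by end_near. Qed.

(* Raising both exponents by one makes the density bounded; [beta_kernel_derive]
   relates the original density to the raised one. *)
Lemma beta_primitive P Q : GRing.comm P Q -> positive_stable P ->
  positive_stable Q ->
  exists Psi L0 L1, [/\ forall u, 0 < u < 1 -> mx_derive Psi u (beta_density P
    Q u),
    Psi s @[s --> 0^'+] --> (L0 : mat) & Psi s @[s --> 1^'-] --> (L1 : mat)].
Proof.
move=> PQ hP hQ; have fc := beta_kernel_ext_continuous PQ hP hQ.
(* The interval from -1 to 2 contains both end points in its interior. *)
have [Lam dLam] := @continuous_primitive _ _ _ (- 1) 2 fc.
(* For the kernel [h] and the density [w], [(P + Q + 1) h - (u h)' = Q (u w)] and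
   [h' + (P + Q) (u w) = P w]. Eliminating [u w] expresses [w] as the derivative of [Psi]. *)
pose N := P^-1; pose O := (P + Q) * Q^-1.
pose Psi u := N * (beta_kernel P Q u + O * ((P + Q + 1) * Lam u -
   u%:C%C *: beta_kernel P Q u)).
have hlim (x : R) (F : set_system R) (FF : Filter F) : -1 < x < 2 ->
    s @[s --> F] --> x -> (\forall s \near F, 0 < s < 1) ->
    (forall e, 0 < e -> \forall s \near F, l1norm (beta_kernel P Q s) <= e) ->
    Psi s @[s --> F] --> N * (0 + O * ((P + Q + 1) * Lam x - 0)).
  move=> x12 Fx F01 hs.
  apply: cvgM_mx; first exact: cvg_cst.
  apply: cvgD_mx; first exact: cvg_mx0P.
  apply: cvgM_mx; first exact: cvg_cst.
  apply: cvgB_mx.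
    apply: cvgM_mx; first exact: cvg_cst.
    by apply: cvg_comp Fx _; apply: mx_derive_continuous (dLam x x12).
  apply: cvg_mx0P => // e e0; near=> s; rewrite l1normZ.
  have /andP[s0 s1] : 0 < s < 1 by near: s.
  rewrite (@le_trans _ _ (l1norm (beta_kernel P Q s)))//.
    by rewrite ler_piMl ?l1norm_ge0// ger0_norm ltW.
  by near: s; exact: hs.
exists Psi, (N * (0 + O * ((P + Q + 1) * Lam 0 - 0))),
  (N * (0 + O * ((P + Q + 1) * Lam 1 - 0))); split.
- move=> u u01; have /andP[u0 u1] := u01.
  have dL : mx_derive Lam u (beta_kernel P Q u).
    have := dLam u; rewrite u01; apply; apply/andP; split; lra.
  have dh := beta_kernel_derive PQ u01.
  have duh := mx_deriveZ (is_derive_id u (1 : R)) dh.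
  apply: mx_derive_eq (mx_deriveMl N (mx_deriveD dh (mx_deriveMl O
    (mx_deriveB (mx_deriveMl (P + Q + 1) dL) duh)))) _.
  rewrite (beta_kernelE _ _ u01); set w := beta_density P Q u.
  have Pu : P \is a GRing.unit := positive_stable_unit hP.
  have Qu : Q \is a GRing.unit := positive_stable_unit hQ.
  have -> : (P + Q + 1) * ((u * (1 - u))%:C%C *: w) -
     (1%:C%C *: ((u * (1 - u))%:C%C *: w) +
      u%:C%C *: (((1 - u)%:C%C *: P - u%:C%C *: Q) * w)) = Q * (u%:C%C *: w).
    rewrite !mulrDl mul1r mulNr -!scalerAl -!scalerAr.
    by apply: mxpart_inj => p; rewrite !(mxpartD, mxpartN, mxpartZ); ring.
  rewrite /O -mulrA mulKr//.
  have -> : ((1 - u)%:C%C *: P - u%:C%C *: Q) * w + (P + Q) * (u%:C%C *: w) = P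
    * w.
    rewrite !mulrDl mulNr -!scalerAl -!scalerAr.
    by apply: mxpart_inj => p; rewrite !(mxpartD, mxpartN, mxpartZ); ring.
  by rewrite /N mulKr.
- apply: hlim; first by rewrite ltrN10 ltr0n.
  + exact: cvg_within.
  + near=> s; apply/andP; split; near: s; [exact: nbhs_right_gt|exact:
    nbhs_right_lt].
  + move=> e e0; have [eta eta0 H] := beta_kernel_small hP hQ e0.
    near=> s; apply: H; last by apply/orP; left; near: s; exact: nbhs_right_lt.
    by apply/andP; split; near: s; [exact: nbhs_right_gt|exact: nbhs_right_lt].
- apply: hlim; first by apply/andP; split; lra.
  + exact: cvg_within.
  + near=> s; apply/andP; split; near: s; [exact: nbhs_left_gt|exact:
    nbhs_left_lt].
  + move=> e e0; have [eta eta0 H] := beta_kernel_small hP hQ e0.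
    near=> s; apply: H; last first.
      by apply/orP; right; near: s; apply: nbhs_left_gt; rewrite gtrBl.
    by apply/andP; split; near: s; [exact: nbhs_left_gt|exact: nbhs_left_lt].
Unshelve. all: by end_near. Qed.

End BetaKernel.

(** * Summation by parts *)

Section AbelSummation.
Variables (R : realType) (n k : nat).
Local Notation mat := 'M[R[i]]_n.+1.
Variables (P Q S : mat) (b : nat -> mat).
Hypotheses (k0 : (0 < k)%N) (PQ : GRing.comm P Q).
Hypotheses (hP : positive_stable P) (hQ : positive_stable Q).
Hypothesis hb : series b @ \oo --> S.
Implicit Types (u v r e : R).

Definition series_tail l : mat := S - series b l.

Definition poch_quotient j : mat := (pochhammer P j)^-1 * pochhammer (P + Q) j.

Definition abel_coef j : mat := poch_ratio P Q j * series_tail (j %/ k).+1.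

Definition abel_sum u : mat := limn (mx_pseries abel_coef u).

Definition abel_diff u : mat := limn (mx_pseries (mx_diffs abel_coef) u).

Lemma series_tailS l : series_tail l.+1 = series_tail l - b l.
Proof. by rewrite /series_tail /series /= big_nat_recr//= opprD addrA. Qed.

Lemma series_tail_small e : 0 < e ->
  exists N, forall l, (N <= l)%N -> l1norm (series_tail l) <= e.
Proof.
move=> e0; have /cvg_l1normP/cvgr0Pnorm_le/(_ e e0)[N _ H] := hb.
by exists N => l /H; rewrite ger0_norm ?l1norm_ge0// l1norm_distC.
Qed.

Lemma series_tail_bounded : exists2 T, 0 <= T & forall l, l1norm (series_tail
  l) <= T.
Proof.
have [N H] := series_tail_small ltr01.
have s0 : 0 <= \sum_(i < N) l1norm (series_tail i) by apply: sumr_ge0 => i _;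
  exact: l1norm_ge0.
exists (1 + \sum_(i < N) l1norm (series_tail i)); first by rewrite addr_ge0.
move=> l; have [lN|Nl] := ltnP l N; last by rewrite (le_trans (H l Nl))// lerDl.
rewrite (bigD1 (Ordinal lN))//= addrCA lerDl addr_ge0//.
by apply: sumr_ge0 => i _; exact: l1norm_ge0.
Qed.

Lemma poch_ratioDn j : (P + j%:R) * poch_ratio P Q j = poch_quotient j.
Proof.
rewrite /poch_ratio pochhammerS invrM ?unit_pochhammer//; last first.
  exact/positive_stable_unit/positive_stableDn.
by rewrite -mulrA mulVKr//; exact/positive_stable_unit/positive_stableDn.
Qed.

Lemma poch_ratioDDn j : (P + Q + j%:R) * poch_ratio P Q j = poch_quotient j.+1.
Proof.
rewrite /poch_quotient [pochhammer (P + Q) j.+1]pochhammerS [RHS]mulrA.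
suff h : GRing.comm (P + Q + j%:R) (poch_ratio P Q j) by exact: h.
have QP := commr_sym PQ.
by apply: comm_poch_ratio; commute.
Qed.

(** One term of the kernel sum at [u = r] is below the whole sum; the factor [(1 - r)^Q] is then
    removed by its inverse. *)
Lemma abel_coef_bounded r : 0 < r < 1 ->
  exists K, forall j, l1norm (abel_coef j) * r ^+ j <= K.
Proof.
move=> r01; have /andP[r0 r1] := r01.
have [C C0 bC] := mx_kernel_sum_bound PQ hP hQ;
  have [T T0 bT] := series_tail_bounded.
exists (l1norm (mx_pow (1 - r) (- Q)) * C * T) => j.
have hj : l1norm (mx_pow (1 - r) Q * poch_ratio P Q j) * r ^+ j <= C.
  rewrite mulrC; apply: le_trans (bC r j.+1 r01).
  rewrite big_ord_recr /= lerDr sumr_ge0// => l _.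
  by rewrite mulr_ge0 ?l1norm_ge0 ?exprn_ge0 ?(ltW r0).
set x := mx_pow (1 - r) Q * poch_ratio P Q j in hj *.
set a := mx_pow (1 - r) (- Q).
have xE : abel_coef j = a * x * series_tail (j %/ k).+1.
  rewrite /abel_coef /a /x [in RHS]mulrA -[X in _ = mx_pow _ (- Q) * mx_pow _ X
    * _ * _]opprK.
  by rewrite mx_powNK mul1r.
have h : l1norm (abel_coef j) <= l1norm a * l1norm x * T.
  rewrite xE; apply: le_trans (l1normM _ _) _.
  by apply: ler_pM; [exact: l1norm_ge0|exact: l1norm_ge0|exact: l1normM|exact:
    bT].
apply: le_trans (ler_wpM2r (exprn_ge0 j (ltW r0)) h) _.
have -> : l1norm a * l1norm x * T * r ^+ j = l1norm a * (l1norm x * r ^+ j) * T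
  by ring.
by rewrite ler_wpM2r// ler_wpM2l ?l1norm_ge0.
Qed.

(** Continuity of [abel_diff] comes from differentiating once more, which takes a second radius [r']
    between [u] and [r]. *)
Lemma abel_sumP u : 0 < u < 1 -> [/\
  mx_pseries abel_coef u @ \oo --> abel_sum u,
  mx_pseries (mx_diffs abel_coef) u @ \oo --> abel_diff u,
  mx_derive abel_sum u (abel_diff u) &
  abel_diff s @[s --> u] --> abel_diff u].
Proof.
move=> /andP[u0 u1]; pose r := (1 + u) / 2; pose r' := (u + r) / 2.
have [|K aK] := @abel_coef_bounded r; first by rewrite /r; lra.
have ur : `|u| < r by rewrite ger0_norm ?(ltW u0)// /r; lra.
have [|K' aK'] := @mx_diffs_bounded _ _ abel_coef r r' K _ aK.
  by rewrite /r' /r; lra.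
have ur' : `|u| < r' by rewrite ger0_norm ?(ltW u0)// /r' /r; lra.
have [c1 d1] := mx_pseries_derive aK ur.
have [_ d2] := mx_pseries_derive aK' ur'.
split; [exact: mx_pseries_cvg aK ur|exact: c1|exact: d1|].
exact: mx_derive_continuous d2.
Qed.

Lemma abel_kernel_cvg u : 0 < u < 1 ->
  \sum_(0 <= j < m) (u ^+ j)%:C%C *: (mx_pow (1 - u) Q * abel_coef j) @[m -->
    \oo]
    --> mx_pow (1 - u) Q * abel_sum u.
Proof.
move=> u01; have [c _ _ _] := abel_sumP u01.
have : mx_pow (1 - u) Q * mx_pseries abel_coef u m @[m --> \oo]
    --> mx_pow (1 - u) Q * abel_sum u.
  by apply: cvgM_mx; [exact: cvg_cst|exact: c].
suff -> : (fun m => mx_pow (1 - u) Q * mx_pseries abel_coef u m) =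
  (fun m => \sum_(0 <= j < m) (u ^+ j)%:C%C *: (mx_pow (1 - u) Q * abel_coef
    j)) by [].
apply/funext => m; rewrite /mx_pseries /series /= mulr_sumr.
by apply: eq_bigr => j _; rewrite -scalerAr.
Qed.

Lemma abel_term_le u j T : 0 < u < 1 -> l1norm (series_tail (j %/ k).+1) <= T ->
  l1norm ((u ^+ j)%:C%C *: (mx_pow (1 - u) Q * abel_coef j)) <=
  u ^+ j * l1norm (mx_pow (1 - u) Q * poch_ratio P Q j) * T.
Proof.
move=> /andP[u0 u1] hT; rewrite l1normZ ger0_norm ?exprn_ge0 ?(ltW u0)// -mulrA.
rewrite ler_wpM2l ?exprn_ge0 ?(ltW u0)// /abel_coef mulrA.
by rewrite (le_trans (l1normM _ _))// ler_wpM2l ?l1norm_ge0.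
Qed.

Lemma abel_kernel_bounded : exists2 K, 0 <= K &
  forall u, 0 < u < 1 -> l1norm (mx_pow (1 - u) Q * abel_sum u) <= K.
Proof.
have [C C0 bC] := mx_kernel_sum_bound PQ hP hQ;
  have [T T0 bT] := series_tail_bounded.
exists (C * T); first by rewrite mulr_ge0.
move=> u u01; apply: (l1norm_lim_le (abel_kernel_cvg u01)); near=> m.
rewrite (le_trans (l1norm_sum _ _ _))// big_mkord.
apply: le_trans (ler_wpM2r T0 (bC u m u01)); rewrite mulr_suml.
by apply: ler_sum => j _; exact: abel_term_le.
Unshelve. all: by end_near. Qed.

(* Abel's argument: the tails with large index are small, and each of the
   remaining finitely many terms vanishes with [(1 - u) ^ Q]. *)
Lemma abel_kernel_small e : 0 < e ->
  exists2 eta, 0 < eta & forall u, 0 < u < 1 -> 1 - eta < u ->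
    l1norm (mx_pow (1 - u) Q * abel_sum u) <= e.
Proof.
move=> e0; have [C C0 bC] := mx_kernel_sum_bound PQ hP hQ.
have [T T0 bT] := series_tail_bounded.
have C1 : 0 < C + 1 by rewrite ltr_wpDl.
have e1 : 0 < e / 2 / (C + 1) by rewrite !divr_gt0.
(* From [j >= k N] on, the tail attached to [j] has index at least [N]. Below, [A + 1] and [C + 1]
   serve as divisors because [A] and [C] may be 0. *)
have [N bN] := series_tail_small e1; pose M := (k * N)%N.
pose A := \sum_(j < M) l1norm (poch_ratio P Q j) * T.
have A0 : 0 <= A by apply: sumr_ge0 => j _; rewrite mulr_ge0 ?l1norm_ge0.
have A1 : 0 < A + 1 by rewrite ltr_wpDl.
have e2 : 0 < e / 2 / (A + 1) by rewrite !divr_gt0.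
have [eta eta0 small] := mx_pow_small hQ e2.
exists eta => // u u01 ueta; have /andP[u0 u1] := u01.
apply: (l1norm_lim_le (abel_kernel_cvg u01)); near=> m.
rewrite (le_trans (l1norm_sum _ _ _))//.
pose t j := u ^+ j * l1norm (mx_pow (1 - u) Q * poch_ratio P Q j).
have t0 j : 0 <= t j by rewrite mulr_ge0 ?l1norm_ge0 ?exprn_ge0 ?(ltW u0).
pose s j := if (j < M)%N then t j * T else 0.
have bnd j : l1norm ((u ^+ j)%:C%C *: (mx_pow (1 - u) Q * abel_coef j)) <=
    s j + t j * (e / 2 / (C + 1)).
  rewrite /s; case: ltnP => jM.
    rewrite (le_trans (abel_term_le u01 (bT _)))// lerDl.
    by rewrite mulr_ge0// ltW.
  rewrite add0r; apply: abel_term_le => //; apply: bN.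
  by rewrite leqW// leq_divRL// mulnC.
rewrite (le_trans (ler_sum _ (fun j _ => bnd j)))// big_split /= -mulr_suml.
rewrite [leRHS](splitr e).
apply: lerD.
  apply: (@le_trans _ _ (\sum_(j < M) t j * T)).
    have Mm : (M <= m)%N by near: m; exact: nbhs_infty_ge.
    rewrite (big_cat_nat _ Mm)//= [X in _ + X]big_nat_cond [X in _ + X]big1 =>
      [|j].
      by rewrite addr0 big_mkord; apply: ler_sum => j _; rewrite /s ltn_ord.
    by rewrite andbT => /andP[Mj _]; rewrite /s ltnNge Mj.
  have nu : l1norm (mx_pow (1 - u) Q) <= e / 2 / (A + 1).
    by apply: small; apply/andP; split; lra.
  apply: (@le_trans _ _ (e / 2 / (A + 1) * A)).
    rewrite mulr_sumr; apply: ler_sum => j _; rewrite mulrA ler_wpM2r//.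
    rewrite /t -[leRHS]mul1r; apply: ler_pM;
      rewrite ?l1norm_ge0 ?exprn_ge0 ?(ltW u0)//.
      by rewrite exprn_ile1// ltW.
    by rewrite (le_trans (l1normM _ _))// ler_wpM2r ?l1norm_ge0.
  have -> : e / 2 / (A + 1) * A = e / 2 * (A / (A + 1)) by ring.
  by rewrite ler_piMr ?divr_ge0 ?(ltW e0)// ler_pdivrMr// mul1r lerDl.
apply: (@le_trans _ _ (C * (e / 2 / (C + 1)))).
  by rewrite ler_wpM2r ?(ltW e1)// big_mkord; exact: bC.
have -> : C * (e / 2 / (C + 1)) = e / 2 * (C / (C + 1)) by ring.
by rewrite ler_piMr ?divr_ge0 ?(ltW e0)// ler_pdivrMr// mul1r lerDl.
Unshelve. all: by end_near. Qed.

(* [beta_density P Q u * abel_bracket u] is the derivative of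
   [beta_kernel P Q u * abel_sum u], and [bracket_coef] lists the coefficients
   of its power series. *)
Definition abel_bracket u : mat :=
  P * abel_sum u + u%:C%C *: abel_diff u -
  u%:C%C *: ((P + Q) * abel_sum u + u%:C%C *: abel_diff u).

Definition bracket_coef j : mat :=
  (P + j%:R) * abel_coef j -
  (if j is j'.+1 then (P + Q + j'%:R) * abel_coef j' else 0).

(** Both parts carry the factor [poch_quotient j], with the tails for [j] and [j - 1]. These
    coincide unless [k] divides [j], when they differ by [b (j %/ k)]. At [j = 0] the second part is
    absent and the tail [S - b 0] is left, which is where [S] comes from. *)
Lemma bracket_coefE j : bracket_coef j =
  (if j == 0%N then S else 0) - (if (k %| j)%N then poch_quotient j * b (j %/
    k) else 0).
Proof.
rewrite /bracket_coef /abel_coef mulrA poch_ratioDn; case: j => [|j] /=.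
  rewrite dvdn0 div0n /poch_quotient !pochhammer0 invr1 !mul1r subr0.
  by rewrite /series_tail /series /= big_nat1.
rewrite mulrA poch_ratioDDn divnS// sub0r -mulrBr; case: (k %| j.+1)%N => /=.
  rewrite add1n -mulrN; congr (_ * _).
  by rewrite (series_tailS _.+1) addrAC subrr add0r.
by rewrite add0n subrr mulr0 oppr0.
Qed.

Lemma bracket_partial_sum u L : (0 < L)%N ->
  \sum_(0 <= j < k * L) (u ^+ j)%:C%C *: bracket_coef j =
  S - \sum_(0 <= l < L) (u ^+ (k * l))%:C%C *: (poch_quotient (k * l) * b l).
Proof.
(* Each block of length [k] contains exactly one multiple of [k], its first index. *)
have block m : \sum_(k * m <= j < k * m.+1) (u ^+ j)%:C%C *: bracket_coef j =
    (if m == 0%N then S else 0) -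
    (u ^+ (k * m))%:C%C *: (poch_quotient (k * m) * b m).
  rewrite big_ltn; last by rewrite ltn_pmul2l.
  rewrite big_nat_cond big1 ?addr0 => [|j].
    rewrite bracket_coefE dvdn_mulr// mulKn// muln_eq0 (gtn_eqF k0) /= scalerBr.
    by case: m => [|m] /=; rewrite ?muln0 ?expr0 ?scale1r ?scaler0.
  rewrite andbT => /andP[j1 j2].
  have kj : (k %| j)%N = false.
    apply/negP => /dvdnP[q jE]; move: j1 j2;
      rewrite jE [(q * k)%N]mulnC !ltn_pmul2l// ltnS.
    by move=> h1 h2; move: (leq_trans h1 h2); rewrite ltnn.
  rewrite bracket_coefE kj subr0; case: j j1 {j2 kj} => [//|j] _ /=.
  by rewrite scaler0.
case: L => [//|L] _; elim: L => [|L IH].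
  by have := block 0%N; rewrite [(k * 0)%N]muln0 eqxx big_nat1 muln0.
rewrite (@big_cat_nat _ _ _ (k * L.+1))//=; last by rewrite leq_pmul2l.
by rewrite IH block /= sub0r [in RHS]big_nat_recr//= opprD addrA.
Qed.

Lemma bracket_cvg u : 0 < u < 1 ->
  \sum_(0 <= j < m) (u ^+ j)%:C%C *: bracket_coef j @[m --> \oo] -->
    abel_bracket u.
Proof.
move=> u01; have [c1 c2 _ _] := abel_sumP u01.
pose x m := mx_pseries abel_coef u m.
pose B m := u%:C%C *: mx_pseries (mx_diffs abel_coef) u m.
pose B' m := \sum_(0 <= j < m) (u ^+ j)%:C%C *: ((j%:R : R)%:C%C *: abel_coef
  j).
have BE m : B' m.+1 = B m.
  rewrite /B' /B /mx_pseries /series /= big_nat_recl// mulr0n rmorph0 scale0r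
    scaler0 add0r.
  rewrite scaler_sumr; apply: eq_bigr => j _.
  by rewrite /mx_diffs !scalerA -!rmorphM exprS.
(* The second part of [bracket_coef] is absent at 0; reindexing it brings out a factor [u] and
   leaves one term fewer, whence [x m.+1] against [x m]. *)
have AE m : \sum_(0 <= j < m.+1) (u ^+ j)%:C%C *: bracket_coef j =
    P * x m.+1 + B' m.+1 - u%:C%C *: ((P + Q) * x m + B' m).
  rewrite /bracket_coef.
  under eq_bigr do rewrite scalerBr; rewrite sumrB; congr (_ - _).
    rewrite /x /B' /mx_pseries /series /= mulr_sumr -big_split /=.
    apply: eq_bigr => j _; rewrite mulrDl scalerDr -scalerAr;
      congr (_ + _ *: _).
    by rewrite rmorph_nat scaler_nat mulr_natl.
  rewrite big_nat_recl// scaler0 add0r /x /B' /mx_pseries /series /=.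
  rewrite mulr_sumr -big_split /= scaler_sumr; apply: eq_bigr => j _.
  rewrite exprS rmorphM -scalerA; congr (_ *: _).
  rewrite mulrDl scalerDr -scalerAr; congr (_ + _ *: _).
  by rewrite rmorph_nat scaler_nat mulr_natl.
have cZ (f : nat -> mat) (M : mat) : f m @[m --> \oo] --> M ->
    u%:C%C *: f m @[m --> \oo] --> u%:C%C *: M.
  move=> fM; have : (u%:C%C *: (1 : mat)) * f m @[m --> \oo] --> (u%:C%C *: (1
    : mat)) * M.
    by apply: cvgM_mx; [exact: cvg_cst|exact: fM].
  by rewrite -scalerAl mul1r; under eq_fun do rewrite -scalerAl mul1r.
have cB : B m @[m --> \oo] --> u%:C%C *: abel_diff u by exact: cZ.
have cB' : B' m @[m --> \oo] --> u%:C%C *: abel_diff u.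
  by rewrite -cvg_shiftS; under eq_fun do rewrite BE.
rewrite -cvg_shiftS; under eq_fun do rewrite AE.
apply: cvgB_mx.
  apply: cvgD_mx; last (rewrite (cvg_shiftS B'); exact: cB').
  apply: cvgM_mx; first exact: cvg_cst.
  rewrite (cvg_shiftS x); exact: c1.
apply: cZ; apply: cvgD_mx; last exact: cB'.
by apply: cvgM_mx; [exact: cvg_cst|exact: c1].
Qed.

(** By [bracket_partial_sum], its partial sums are [S] minus those of the bracket series read at the
    multiples of [k]. *)
Lemma abel_series_cvg u : 0 < u < 1 ->
  series (fun l => (u ^+ (k * l))%:C%C *: (poch_quotient (k * l) * b l)) @ \oo
    -->
  S - abel_bracket u.
Proof.
move=> u01; have h := bracket_cvg u01.
have kL : (k * L)%N @[L --> \oo] --> \oo.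
  move=> A [N _ HA]; exists N => // L /= NL; apply: HA => /=.
  by rewrite (leq_trans NL)// leq_pmull.
have h2 : S - \sum_(0 <= j < k * L) (u ^+ j)%:C%C *: bracket_coef j @[L -->
  \oo] -->
    S - abel_bracket u.
  by apply: cvgB_mx; [exact: cvg_cst|exact: cvg_comp kL h].
apply: cvg_trans h2; apply: near_eq_cvg; near=> L.
have L0 : (0 < L)%N by near: L; exact: nbhs_infty_gt.
by rewrite (bracket_partial_sum _ L0) opprB addrC subrK.
Unshelve. all: by end_near. Qed.

Definition abel_primitive u : mat := beta_kernel P Q u * abel_sum u.

Lemma comm_beta_density M u : GRing.comm M P -> GRing.comm M Q ->
  GRing.comm M (beta_density P Q u).
Proof. by move=> MP MQ; rewrite /beta_density; commute. Qed.

Lemma abel_primitive_derive u : 0 < u < 1 ->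
  mx_derive abel_primitive u (beta_density P Q u * abel_bracket u).
Proof.
move=> u01; have [_ _ dX _] := abel_sumP u01.
apply: mx_derive_eq (mx_deriveM (beta_kernel_derive PQ u01) dX) _.
rewrite (beta_kernelE _ _ u01).
have wP : P * beta_density P Q u = beta_density P Q u * P.
  by apply: comm_beta_density; [exact: commr_refl|exact: PQ].
have wQ : Q * beta_density P Q u = beta_density P Q u * Q.
  by apply: comm_beta_density; [exact: commr_sym|exact: commr_refl].
rewrite /abel_bracket; move: wP wQ; set w := beta_density P Q u.
set X := abel_sum u; set X' := abel_diff u; clearbody w X X' => wP wQ.
have wPX : P * (w * X) = w * (P * X) by rewrite !mulrA wP.
have wQX : Q * (w * X) = w * (Q * X) by rewrite !mulrA wQ.
rewrite !(mulrBl, mulrDl, mulrBr, mulrDr) -!scalerAl -!scalerAr.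
rewrite !(mulrBr, mulrDr) -!scalerAr -!mulrA wPX wQX.
by apply: mxpart_inj => p; rewrite !(mxpartD, mxpartN, mxpartZ); ring.
Qed.

(** Near 0 the power [u^P] vanishes and the rest is bounded; near 1 the roles are exchanged and
    Abel's argument supplies the small factor. *)
Lemma abel_primitive_cvg0 : abel_primitive s @[s --> 0^'+] --> (0 : mat).
Proof.
have [K K0 bK] := abel_kernel_bounded; apply: cvg_mx0P => e e0.
have K1 : 0 < K + 1 by rewrite ltr_wpDl.
have [eta eta0 H] := mx_pow_small hP (divr_gt0 e0 K1).
near=> s; have s0 : 0 < s by near: s; exact: nbhs_right_gt.
have s1 : s < 1 by near: s; exact: nbhs_right_lt.
have se : s < eta by near: s; exact: nbhs_right_lt.
rewrite /abel_primitive /beta_kernel -mulrA; apply: le_trans (l1normM _ _) _.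
rewrite -[leRHS](divfK (lt0r_neq0 K1)); apply: ler_pM; rewrite ?l1norm_ge0//.
  by apply: H; rewrite s0.
by apply: le_trans (bK s _) _; rewrite ?s0// lerDl.
Unshelve. all: by end_near. Qed.

Lemma abel_primitive_cvg1 : abel_primitive s @[s --> 1^'-] --> (0 : mat).
Proof.
have [K K0 bK] := mx_pow_bounded01 hP; apply: cvg_mx0P => e e0.
have [eta eta0 H] := abel_kernel_small (divr_gt0 e0 K0).
near=> s; have s0 : 0 < s by near: s; exact: nbhs_left_gt.
have s1 : s < 1 by near: s; exact: nbhs_left_lt.
have se : 1 - eta < s by near: s; apply: nbhs_left_gt; rewrite gtrBl.
rewrite /abel_primitive /beta_kernel -mulrA; apply: le_trans (l1normM _ _) _.
rewrite mulrC -[leRHS](divfK (lt0r_neq0 K0)); apply: ler_pM;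
  rewrite ?l1norm_ge0//.
  by apply: H; rewrite ?s0.
by apply: bK; rewrite s0 ltW.
Unshelve. all: by end_near. Qed.

Lemma abel_bracket_continuous u : 0 < u < 1 ->
  abel_bracket s @[s --> u] --> abel_bracket u.
Proof.
move=> u01; have [_ _ dX cX'] := abel_sumP u01;
  have cX := mx_derive_continuous dX.
have cid (f : R -> mat) : f s @[s --> u] --> f u ->
    s%:C%C *: f s @[s --> u] --> u%:C%C *: f u.
  move=> fu; have c1 : s%:C%C *: (1 : mat) @[s --> u] --> u%:C%C *: (1 : mat).
    apply: mx_derive_continuous.
    exact: mx_deriveZ (is_derive_id u (1 : R)) (@mx_derive_cst _ _ (1 : mat) u).
  have : (s%:C%C *: (1 : mat)) * f s @[s --> u] --> (u%:C%C *: (1 : mat)) * f u.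
    by apply: cvgM_mx; [exact: c1|exact: fu].
  by rewrite -scalerAl mul1r; under eq_fun do rewrite -scalerAl mul1r.
have cP (M : mat) : M * abel_sum s @[s --> u] --> M * abel_sum u.
  by apply: cvgM_mx; [exact: cvg_cst|exact: cX].
apply: cvgB_mx; first by apply: cvgD_mx; [exact: cP|exact: cid].
apply: (cid (fun s => (P + Q) * abel_sum s + s%:C%C *: abel_diff s)).
by apply: cvgD_mx; [exact: cP|exact: cid].
Qed.

End AbelSummation.

(** * The beta transform of the series *)

Lemma conj_cancel (T : unitRingType) (a p q : T) :
  p \is a GRing.unit -> q \is a GRing.unit ->
  GRing.comm a p -> GRing.comm a q -> GRing.comm p q ->
  p^-1 * q * (a * p) * q^-1 = a.
Proof.
move=> pu qu ap aq pq.
by rewrite ap mulrA -(mulrA _ q) -pq mulKr// -aq mulrK.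
Qed.

Section ParameterMultiplication.
Variables (R : realType) (n : nat).
Local Notation mat := 'M[R[i]]_n.+1.
Implicit Types (M P Q : mat) (A B : seq mat).

Lemma prod_scale (c : R[i]) (I : Type) (s : seq I) (F : I -> mat) :
  \prod_(i <- s) (c *: F i) = c ^+ size s *: \prod_(i <- s) F i.
Proof.
elim: s => [|i s IH]; first by rewrite !big_nil expr0 scale1r.
by rewrite !big_cons IH -scalerAl -scalerAr scalerA exprS.
Qed.

Lemma pochhammer_addn M m k :
  pochhammer M (m + k) = pochhammer M m * \prod_(i <- iota 0 k) (M + (m +
    i)%:R).
Proof.
elim: k => [|k IH]; first by rewrite addn0 big_nil mulr1.
have -> : iota 0 k.+1 = iota 0 k ++ [:: k] by rewrite -addn1 iotaD.
by rewrite addnS pochhammerS IH big_cat big_seq1 mulrA.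
Qed.

(** Multiplication formula for Pochhammer symbols: passing from [l] to [l + 1] adds the [k] factors
    [(M + i) / k + l = (M + (k l + i)) / k]. *)
Lemma prod_pochhammer_Delta k M l : (0 < k)%N ->
  \prod_(N <- Delta k M) pochhammer N l =
  (k%:R ^- (k * l)) *: pochhammer M (k * l).
Proof.
move=> k0; have kn : (k%:R : R[i]) != 0 by rewrite pnatr_eq0 -lt0n.
pose c : R[i] := k%:R^-1; rewrite /Delta big_map -/c.
elim: l => [|l IH].
  rewrite muln0 expr0 invr1 scale1r pochhammer0.
  by rewrite big1_seq// => i _; rewrite pochhammer0.
under eq_bigr do rewrite pochhammerS.
have cM i j : GRing.comm (c *: (M + i%:R)) (c *: (M + j%:R)).
  by apply: comm_scale; commute.
rewrite prodrM_comm => [|i j _ _]; last first.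
  apply: commr_sym; apply: comm_pochhammer; apply: commr_sym.
  apply: commrD; [exact: cM|exact: commr_nat].
rewrite IH mulnS addnC pochhammer_addn -scalerAl.
have -> : \prod_(i <- iota 0 k) (c *: (M + i%:R) + l%:R) =
    c ^+ k *: \prod_(i <- iota 0 k) (M + (k * l + i)%:R).
  rewrite -{2}(size_iota 0 k) -prod_scale; apply: eq_bigr => i _.
  rewrite natrD [_ + i%:R]addrC addrA [RHS]scalerDr; congr (_ + _).
  by rewrite natrM mulr_natl -[_ *+ k]scaler_nat scalerA mulVf ?scale1r.
rewrite -scalerAr scalerA; congr (_ *: _).
by rewrite /c exprVn -invfM -exprD addnC.
Qed.

Lemma unit_prod_pochhammer B l : (forall M, M \in B -> positive_stable M) ->
  \prod_(M <- B) pochhammer M l \is a GRing.unit.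
Proof.
move=> hB; rewrite big_seq; apply: (big_ind (fun X : mat => X \is a
  GRing.unit)).
- exact: unitr1.
- by move=> X Y uX uY; rewrite unitrMr.
- by move=> M MB; apply: unit_pochhammer; exact: hB.
Qed.

Lemma comm_prod_pochhammer M A l : (forall N, N \in A -> GRing.comm M N) ->
  GRing.comm M (\prod_(N <- A) pochhammer N l).
Proof.
by move=> h; rewrite big_seq; apply: commr_prod => N NA;
  apply: comm_pochhammer; exact: h.
Qed.

Lemma inc_exp_term_scale (x : R) P Q (z w : R[i]) A B l :
  inc_exp_term x P Q (z * w) A B l = w ^+ l *: inc_exp_term x P Q z A B l.
Proof. by rewrite /inc_exp_term scalerA exprMn mulrA [w ^+ l * _]mulrC. Qed.

(** The powers of [k] coming from the two lists [Delta] cancel. The remaining symbols of [P] and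
    [P + Q] are moved past the product over [A]; the inverse of the product over [B] already stands
    to their right. *)
Lemma inc_exp_term_Delta (x : R) P Q (z : R[i]) A B k l : (0 < k)%N ->
  GRing.comm P Q -> positive_stable P -> positive_stable Q ->
  (forall M, M \in A -> GRing.comm P M /\ GRing.comm Q M) ->
  (forall M, M \in B -> positive_stable M) ->
  inc_exp_term x P Q z A B l = poch_quotient P Q (k * l) *
    inc_exp_term x P Q z (A ++ Delta k P) (B ++ Delta k (P + Q)) l.
Proof.
move=> k0 PQ hP hQ cA hB; rewrite /inc_exp_term -scalerAr; congr (_ *: _).
move: (mx_inc_Gamma _ _) (mx_Gamma _)^-1 => g g'.
rewrite [RHS]mulrA [X in _ = X * _]mulrA; congr (_ * _ * _).
rewrite !big_cat /= !(prod_pochhammer_Delta _ _ k0).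
rewrite /poch_quotient; set kk : R[i] := k%:R ^- (k * l).
have kk0 : kk != 0 by rewrite invr_eq0 expf_neq0// pnatr_eq0 -lt0n.
have hPQ := positive_stableD PQ hP hQ.
have pu := unit_pochhammer (k * l) hP; have qu := unit_pochhammer (k * l) hPQ.
have bu := unit_prod_pochhammer l hB.
set a := \prod_(M <- A) _; set b := \prod_(M <- B) _ in bu *.
have ap : GRing.comm a (pochhammer P (k * l)).
  apply: comm_pochhammer; apply: commr_sym; apply: comm_prod_pochhammer.
  by move=> M /cA[].
have aq : GRing.comm a (pochhammer (P + Q) (k * l)).
  apply: comm_pochhammer; apply: commr_sym; apply: comm_prod_pochhammer.
  by move=> M /cA[PM QM]; commute.
have QP := commr_sym PQ.
have pq : GRing.comm (pochhammer P (k * l)) (pochhammer (P + Q) (k * l)).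
  apply: comm_pochhammer; apply: commr_sym; apply: comm_pochhammer.
  by commute.
move: (pochhammer P _) (pochhammer (P + Q) _) => p q in pu qu ap aq pq *.
clearbody a b.
have kqu : kk *: q \is a GRing.unit by rewrite scaler_unit ?unitfE.
rewrite (invrM bu kqu) invrZ ?unitfE//.
rewrite -!(scalerAl, scalerAr) scalerA divff// scale1r.
by rewrite -{1}(conj_cancel pu qu ap aq pq) !mulrA.
Qed.

End ParameterMultiplication.

Lemma cvg_div_at_right0 (R : realType) (t : R) : 0 < t -> u / t @[u --> 0^'+]
  --> 0^'+.
Proof.
move=> t0 A [e /= e0 HA]; exists (e * t) => /=; first by rewrite mulr_gt0.
move=> u /=; rewrite sub0r normrN => ue u0; apply: HA => /=;
  last by rewrite divr_gt0.
by rewrite sub0r normrN normrM normfV (gtr0_norm t0) ltr_pdivrMr.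
Qed.

Lemma cvg_div_at_left1 (R : realType) (t : R) : 0 < t -> u / t @[u --> t^'-]
  --> 1^'-.
Proof.
move=> t0 A [e /= e0 HA]; exists (e * t) => /=; first by rewrite mulr_gt0.
move=> u /= ue ut; apply: HA => /=; last by rewrite ltr_pdivrMr// mul1r.
have -> : 1 - u / t = (t - u) / t by rewrite mulrBl mulfV// gt_eqF.
by rewrite normrM normfV (gtr0_norm t0) ltr_pdivrMr.
Qed.

Lemma mulrBMl0 (T : pzRingType) (a b c d : T) :
  (a - b) * c * d = (a * (c * d) - c * 0) - (b * (c * d) - c * 0).
Proof. by rewrite !mulr0 !subr0 -mulrA mulrBl. Qed.

Section BetaTransform.
Variables (R : realType) (n k : nat).
Local Notation mat := 'M[R[i]]_n.+1.
Implicit Types (P Q S : mat).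

Lemma beta_density_continuous P Q t u : 0 < u < t ->
  mx_pow s (P - 1) * mx_pow (t - s) (Q - 1) @[s --> u] -->
  (mx_pow u (P - 1) * mx_pow (t - u) (Q - 1) : mat).
Proof.
move=> /andP[u0 ut]; apply: cvgM_mx.
  exact: mx_derive_continuous (mx_pow_derive (P - 1) u0).
exact: mx_derive_continuous (mx_pow_subr_derive (Q - 1) ut).
Qed.

Lemma mx_Beta_primitive P Q Psi L0 L1 :
  (forall u, 0 < u < 1 -> mx_derive Psi u (beta_density P Q u)) ->
  Psi s @[s --> 0^'+] --> (L0 : mat) -> Psi s @[s --> 1^'-] --> (L1 : mat) ->
  mx_Beta P Q = L1 - L0.
Proof.
move=> dPsi c0 c1; apply: lim_mx.
have [] := improper_integral_primitive (@ltr01 R) dPsi _ c0 c1; last by [].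
by move=> u u01; exact: beta_density_continuous.
Qed.

(** The exponents of [t] add up to [P + Q - 2]; one factor [t^-1] is kept apart because it is the
    derivative of [u / t] in the change of variable. *)
Lemma beta_density_scale P Q t v : GRing.comm P Q -> 0 < t -> 0 < v < 1 ->
  mx_pow (t * v) (P - 1) * mx_pow (t - t * v) (Q - 1) =
  (t^-1)%:C%C *: (mx_pow t (P + Q - 1) * beta_density P Q v).
Proof.
move=> PQ t0 /andP[v0 v1]; have w0 : 0 < 1 - v by rewrite subr_gt0.
have QP := commr_sym PQ.
rewrite -{2}[t]mulr1 -mulrBr (mx_powM _ t0 v0) (mx_powM _ t0 w0).
rewrite -addrA (mx_powD _ (_ : GRing.comm P (Q - 1))); last by commute.
have -> : mx_pow t P = t%:C%C *: mx_pow t (P - 1) by rewrite -(mx_powS _ t0)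
  subrK.
rewrite -!scalerAl scalerA -rmorphM (mulVf (lt0r_neq0 t0)) scale1r.
rewrite /beta_density; apply/esym/mulrACA_comm.
by commute.
Qed.

Lemma scale_comm_distr (c : R[i]) (w T S X : mat) : GRing.comm T w ->
  (c *: w) * (T * S) - T * (c *: (w * X)) = (c *: (T * w)) * (S - X).
Proof.
move=> Tw; rewrite -!scalerAl -scalerAr -scalerBr mulrBr; congr (_ *: (_ - _)).
  by rewrite mulrA Tw.
by rewrite mulrA.
Qed.

Lemma beta_transform P Q S (b : nat -> mat) (t : R) (f : R -> mat) :
  (0 < k)%N -> 0 < t -> GRing.comm P Q -> positive_stable P -> positive_stable
    Q ->
  series b @ \oo --> S ->
  (forall v, 0 < v < 1 ->
    series (fun l => (v ^+ (k * l))%:C%C *: (poch_quotient P Q (k * l) * b l))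
      @ \oo
      --> f (t * v)) ->
  is_improper_integral
    (fun u => mx_pow u (P - 1) * mx_pow (t - u) (Q - 1) * f u) 0^'+ t^'-
    (mx_Beta P Q * mx_pow t (P + Q - 1) * S).
Proof.
move=> k0 t0 PQ hP hQ hb hf.
have [Psi [L0 [L1 [dPsi cPsi0 cPsi1]]]] := beta_primitive PQ hP hQ.
rewrite (mx_Beta_primitive dPsi cPsi0 cPsi1).
set T := mx_pow t (P + Q - 1).
pose br := abel_bracket k P Q S b; pose H := abel_primitive k P Q S b.
have fE v : 0 < v < 1 -> f (t * v) = S - br v.
  move=> v01; apply: cvg_mx_unique (hf v v01) _.
  exact: (abel_series_cvg k0 PQ hP hQ hb v01).
have QP := commr_sym PQ.
have Tw v : GRing.comm T (beta_density P Q v).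
  apply: commr_sym; apply: comm_mx_pow; apply: commr_sym.
  by apply: comm_beta_density; commute.
have uv u : 0 < u < t -> 0 < u / t < 1.
  by move=> /andP[u0 ut]; rewrite divr_gt0//= ltr_pdivrMr// mul1r.
have tu u : t * (u / t) = u by rewrite mulrC divfK// gt_eqF.
pose G u := Psi (u / t) * (T * S) - T * H (u / t).
(* The value is put in the form of the limit of [G] at [t] minus its limit at 0; the zeros are the
   two limits of [H]. *)
rewrite [X in is_improper_integral _ _ _ X]mulrBMl0.
have dt u : is_derive u (1 : R) (fun s => s / t) t^-1.
  have -> : (fun s => s / t) = t^-1 \*: (id : R -> R).
    by apply/funext => s; rewrite mulrC.
  by apply: is_derive_eq (is_deriveZ t^-1 (is_derive_id u (1 : R))) _;
    rewrite /GRing.scale /= mulr1.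
have fS u : 0 < u < t -> f u = S - br (u / t).
  by move=> ut; rewrite -(fE _ (uv u ut)) tu.
apply: (improper_integral_primitive (F := G)); first exact: t0.
- move=> u ut; have v01 := uv u ut.
  have d1 : mx_derive (fun s => Psi (s / t)) u
      ((t^-1)%:C%C *: beta_density P Q (u / t)).
    exact: mx_derive_comp (dt u) (dPsi _ v01).
  have d2 : mx_derive (fun s => H (s / t)) u
      ((t^-1)%:C%C *: (beta_density P Q (u / t) * br (u / t))).
    have d0 := abel_primitive_derive k PQ hP hQ hb v01.
    exact: mx_derive_comp (dt u) d0.
  apply: mx_derive_eq (mx_deriveB (mx_deriveMr (T * S) d1) (mx_deriveMl T d2))
    _.
  have e1 := beta_density_scale PQ t0 v01; rewrite (tu u) in e1.
  transitivity (((t^-1)%:C%C *: (T * beta_density P Q (u / t))) * (S - br (u /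
    t))).
    exact: scale_comm_distr.
  by congr (_ * _); [exact: esym e1|exact: esym (fS u ut)].
- move=> u ut; have v01 := uv u ut.
  apply: cvgM_mx; first exact: beta_density_continuous.
  have h : S - br (s / t) @[s --> u] --> f u.
    rewrite (fS u ut); apply: cvgB_mx; first exact: cvg_cst.
    apply: cvg_comp (abel_bracket_continuous PQ hP hQ hb v01).
    exact: derive_continuous (dt u).
  have /andP[u0 ut'] := ut.
  apply: cvg_trans h; apply: near_eq_cvg; near=> s; apply/esym/fS.
  apply/andP; split; near: s.
    exact: (lt_nbhsr u0).
  exact: (lt_nbhsl ut').
- apply: cvgB_mx.
    apply: cvgM_mx; last exact: cvg_cst.
    exact: cvg_comp (cvg_div_at_right0 t0) cPsi0.
  apply: cvgM_mx; first exact: cvg_cst.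
  exact: cvg_comp (cvg_div_at_right0 t0) (abel_primitive_cvg0 k PQ hP hQ hb).
- apply: cvgB_mx.
    apply: cvgM_mx; last exact: cvg_cst.
    exact: cvg_comp (cvg_div_at_left1 t0) cPsi1.
  apply: cvgM_mx; first exact: cvg_cst.
  exact: cvg_comp (cvg_div_at_left1 t0) (abel_primitive_cvg1 k0 PQ hP hQ hb).
Unshelve. all: by end_near. Qed.

End BetaTransform.

Theorem theorem3p11 (R : realType) (n r s k : nat) (P Q : 'M[R[i]]_n.+1)
    (A : r.-tuple 'M[R[i]]_n.+1) (B : s.-tuple 'M[R[i]]_n.+1)
    (x t : R) (z : R[i])
    (comm : {in [:: P, Q & A ++ B] &, forall M M' : 'M[R[i]]_n.+1,
      GRing.comm M M'})
    (hP : positive_stable P) (hQ : positive_stable Q)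
    (hA : forall i : 'I_r, positive_stable (tnth A i))
    (hB : forall j : 'I_s, positive_stable (tnth B j))
    (hx : 0 < x) (ht : 0 < t) (hk : (1 <= k)%N)
    (cvgL : forall u : R, 0 < u < t ->
      inc_exp_cvg x P Q (z * (u ^+ k)%:C%C) A B)
    (cvgR : inc_exp_cvg x P Q (z * (t ^+ k)%:C%C)
      (A ++ Delta k P) (B ++ Delta k (P + Q))) :
  is_improper_integral
    (fun u : R => mx_pow u (P - 1) * mx_pow (t - u) (Q - 1) *
                  inc_exp x P Q (z * (u ^+ k)%:C%C) A B)
    0^'+ t^'-
    (mx_Beta P Q * mx_pow t (P + Q - 1) *
     inc_exp x P Q (z * (t ^+ k)%:C%C)
       (A ++ Delta k P) (B ++ Delta k (P + Q))).
Proof.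
have Pin : P \in [:: P, Q & A ++ B] by rewrite inE eqxx.
have Qin : Q \in [:: P, Q & A ++ B] by rewrite !inE eqxx orbT.
have PQ : GRing.comm P Q := comm _ _ Pin Qin.
have cA M : M \in (A : seq _) -> GRing.comm P M /\ GRing.comm Q M.
  move=> MA; have Min : M \in [:: P, Q & A ++ B] by rewrite !inE mem_cat MA
    !orbT.
  by split; apply: comm.
have sB M : M \in (B : seq _) -> positive_stable M.
  by move=> /tnthP[j ->]; exact: hB.
apply: (beta_transform (f := fun u => inc_exp x P Q (z * (u ^+ k)%:C%C) A B)
  hk ht PQ hP hQ cvgR) => v v01.
have /andP[v0 v1] := v01.
set b := inc_exp_term x P Q (z * (t ^+ k)%:C%C) (A ++ Delta k P) (B ++ Delta k
  (P + Q)).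
(* With [u = t v] the argument factors as [(z t^k) v^k], which produces the powers [v^(k l)]. *)
have E : inc_exp_term x P Q (z * ((t * v) ^+ k)%:C%C) A B =
    (fun l => (v ^+ (k * l))%:C%C *: (poch_quotient P Q (k * l) * b l)).
  apply/funext => l; rewrite exprMn rmorphM mulrA inc_exp_term_scale.
  rewrite (inc_exp_term_Delta _ _ _ hk PQ hP hQ cA sB).
  by congr (_ *: _); rewrite exprM [RHS]rmorphXn.
have := cvgL (t * v); rewrite /inc_exp_cvg /inc_exp E; apply.
by rewrite mulr_gt0//= gtr_pMr.
Qed.
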